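(* Let $n\ge 1$, let $\lambda_0\in\mathbb{C}$, and let $\lambda_1^{\mathcal{C}},\dots,\lambda_n^{\mathcal{C}},\lambda_1^{\mathcal{B}},\dots,\lambda_n^{\mathcal{B}}\in\mathbb{C}$. Put $X=\{\lambda_1^{\mathcal{C}},\dots,\lambda_n^{\mathcal{C}}\}$, $Y=\{\lambda_1^{\mathcal{B}},\dots,\lambda_n^{\mathcal{B}}\}$, $X_\lambda=X\setminus\{\lambda\}$, $Y_\lambda=Y\setminus\{\lambda\}$. For $\lambda=\lambda_k^{\mathcal{C}}\in X$, let $\vec X^{0,n}_\lambda$ be the $n$-tuple obtained from $(\lambda_0,\lambda_1^{\mathcal{C}},\dots,\lambda_n^{\mathcal{C}})$ by deleting $\lambda_k^{\mathcal{C}}$; for $\lambda=\lambda_k^{\mathcal{B}}\in Y$, let $\vec Y^{0,n}_\lambda$ be obtained from $(\lambda_0,\lambda_1^{\mathcal{B}},\dots,\lambda_n^{\mathcal{B}})$ by deleting $\lambda_k^{\mathcal{B}}$. Define $$\widetilde M_0=\Lambda_{\tilde{\mathcal{D}}}(\lambda_0)\Big\{\prod_{\lambda\in Y}\frac{a(\lambda_0-\lambda)}{b(\lambda_0-\lambda)}\frac{a(\lambda_0+\lambda+\gamma)}{b(\lambda_0+\lambda+\gamma)}-\prod_{\lambda\in X}\frac{a(\lambda_0-\lambda)}{b(\lambda_0-\lambda)}\frac{a(\lambda_0+\lambda+\gamma)}{b(\lambda_0+\lambda+\gamma)}\Big\},$$ $$\widetilde N^{(\mathcal{C})}_\lambda=-\Lambda_{\mathcal{A}}(\lambda)\frac{c}{a(2\lambda_0)}\frac{b(2\lambda)}{a(2\lambda)}\frac{a(2\lambda_0+\gamma)}{a(\lambda_0+\lambda)}\prod_{\tilde\lambda\in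 X_\lambda}\frac{a(\tilde\lambda-\lambda)}{b(\tilde\lambda-\lambda)}\frac{b(\tilde\lambda+\lambda)}{a(\tilde\lambda+\lambda)}+\Lambda_{\tilde{\mathcal{D}}}(\lambda)\frac{a(2\lambda_0+\gamma)}{b(2\lambda_0+\gamma)}\frac{c}{b(\lambda_0-\lambda)}\prod_{\tilde\lambda\in X_\lambda}\frac{a(\lambda-\tilde\lambda)}{b(\lambda-\tilde\lambda)}\frac{a(\lambda+\tilde\lambda+\gamma)}{b(\lambda+\tilde\lambda+\gamma)}$$ for $\lambda\in X$, and $$\widetilde N^{(\mathcal{B})}_\lambda=\Lambda_{\mathcal{A}}(\lambda)\frac{c}{a(2\lambda_0)}\frac{b(2\lambda)}{a(2\lambda)}\frac{a(2\lambda_0+\gamma)}{a(\lambda_0+\lambda)}\prod_{\tilde\lambda\in Y_\lambda}\frac{a(\tilde\lambda-\lambda)}{b(\tilde\lambda-\lambda)}\frac{b(\tilde\lambda+\lambda)}{a(\tilde\lambda+\lambda)}-\Lambda_{\tilde{\mathcal{D}}}(\lambda)\frac{a(2\lambda_0+\gamma)}{b(2\lambda_0+\gamma)}\frac{c}{b(\lambda_0-\lambda)}\prod_{\tilde\lambda\in Y_\lambda}\frac{a(\lambda-\tilde\lambda)}{b(\lambda-\tilde\lambda)}\frac{a(\lambda+\tilde\lambda+\gamma)}{b(\lambda+\tilde\lambda+\gamma)}$$ for $\lambda\in Y$. Then $$\widetilde M_0\,\mathcal{S}_n(\lambda_1^{\mathcal{C}},\dots,\lambda_n^{\mathcal{C}}\,|\,\lambda_1^{\mathcal{B}},\dots,\lambda_n^{\mathcal{B}})+\sum_{\lambda\in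 X}\widetilde N^{(\mathcal{C})}_\lambda\,\mathcal{S}_n(\vec X^{0,n}_\lambda\,|\,\lambda_1^{\mathcal{B}},\dots,\lambda_n^{\mathcal{B}})+\sum_{\lambda\in Y}\widetilde N^{(\mathcal{B})}_\lambda\,\mathcal{S}_n(\lambda_1^{\mathcal{C}},\dots,\lambda_n^{\mathcal{C}}\,|\,\vec Y^{0,n}_\lambda)=0.$$
   Context: Fix generic $\gamma,h\in\mathbb{C}$, an integer $L\ge1$ and inhomogeneities $\mu_1,\dots,\mu_L\in\mathbb{C}$. Set $a(\lambda)=\sinh(\lambda+\gamma)$, $b(\lambda)=\sinh(\lambda)$, $c=\sinh(\gamma)$ (a constant). Let $\mathcal{R}(\lambda)\in\mathrm{End}(\mathbb{C}^2\otimes\mathbb{C}^2)$ be the six-vertex R-matrix, which in the basis $e_1\otimes e_1,e_1\otimes e_2,e_2\otimes e_1,e_2\otimes e_2$ is $\begin{pmatrix}a(\lambda)&0&0&0\\0&b(\lambda)&c&0\\0&c&b(\lambda)&0\\0&0&0&a(\lambda)\end{pmatrix}$, and let $\mathcal{K}(\lambda)=\mathrm{diag}(\sinh(h+\lambda),\sinh(h-\lambda))$. With auxiliary space $V_0\cong\mathbb{C}^2$ and quantum space $V_{\mathcal{Q}}=(\mathbb{C}^2)^{\otimes L}$, $\mathcal{R}_{0j}$ is $\mathcal{R}$ acting on $V_0\otimes V_j$ and $\mathcal{K}_0$ is $\mathcal{K}$ on $V_0$. Define $\mathcal{A},\mathcal{B},\mathcal{C},\mathcal{D}(\lambda)\in\mathrm{End}(V_{\mathcal{Q}})$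 by $\mathcal{R}_{0L}(\lambda-\mu_L)\cdots\mathcal{R}_{01}(\lambda-\mu_1)\mathcal{K}_0(\lambda)\mathcal{R}_{01}(\lambda+\mu_1)\cdots\mathcal{R}_{0L}(\lambda+\mu_L)=\begin{pmatrix}\mathcal{A}(\lambda)&\mathcal{B}(\lambda)\\\mathcal{C}(\lambda)&\mathcal{D}(\lambda)\end{pmatrix}$ on $V_0$. Let $|0\rangle=(1,0)^{T\otimes L}$, $\langle0|=(1,0)^{\otimes L}$. The scalar product is $\mathcal{S}_n(\lambda_1^{\mathcal{C}},\dots,\lambda_n^{\mathcal{C}}|\lambda_1^{\mathcal{B}},\dots,\lambda_n^{\mathcal{B}})=\langle0|\mathcal{C}(\lambda_n^{\mathcal{C}})\cdots\mathcal{C}(\lambda_1^{\mathcal{C}})\mathcal{B}(\lambda_1^{\mathcal{B}})\cdots\mathcal{B}(\lambda_n^{\mathcal{B}})|0\rangle$. Also $\Lambda_{\mathcal{A}}(\lambda)=b(h+\lambda)\prod_{j=1}^L a(\lambda-\mu_j)a(\lambda+\mu_j)$ and $\Lambda_{\tilde{\mathcal{D}}}(\lambda)=-\frac{b(2\lambda)}{a(2\lambda)}a(\lambda-h)\prod_{j=1}^L b(\lambda-\mu_j)b(\lambda+\mu_j)$. The identity is understood as an identity of meromorphic functions of all variables. *)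

(* Defs.v *)
From HB Require Import structures.
From mathcomp Require Import all_boot all_order all_algebra.
From mathcomp Require Import complex.
From mathcomp Require Import reals sequences exp trigo.

Set Implicit Arguments.
Unset Strict Implicit.
Unset Printing Implicit Defensive.

Import Order.TTheory GRing.Theory Num.Theory.
Local Open Scope ring_scope.
Local Open Scope complex_scope.

Definition cexp (R : realType) (z : R[i]) : R[i] :=
  let: x +i* y := z in (expR x)%:C * (cos y +i* sin y).

Definition csinh (R : realType) (z : R[i]) : R[i] := (cexp z - cexp (- z)) / 2%:R.

Definition wa (R : realType) (g l : R[i]) : R[i] := csinh (l + g).
Definition wb (R : realType) (l : R[i]) : R[i] := csinh l.
Definition wc (R : realType) (g : R[i]) : R[i] := csinh g.

(* Entry  R[(al,i),(be,j)]  of the six-vertex R-matrix in the basis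
   e1(x)e1, e1(x)e2, e2(x)e1, e2(x)e2 (index 0 <-> e_1, 1 <-> e_2);
   first tensor factor = auxiliary space. *)
Definition Rent (R : realType) (g l : R[i]) (al i be j : 'I_2) : R[i] :=
  if (al == be) && (i == j) then (if al == i then wa g l else wb l)
  else if (al == i) || (be == j) || (al == be) || (i == j) then 0
  else wc g.
(* the last branch is exactly (al,i,be,j) = (0,1,1,0) or (1,0,0,1) *)

Definition Kent (R : realType) (h l : R[i]) (al be : 'I_2) : R[i] :=
  if al == be then (if al == ord0 then csinh (h + l) else csinh (h - l)) else 0.

(* basis of the quantum space (C^2)^{(x)L}: spin configurations *)
Definition spin (L : nat) := {ffun 'I_L -> 'I_2}.
(* basis of V_0 (x) V_Q *)
Definition fstate (L : nat) := ('I_2 * spin L)%type.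

Definition kmul (R : realType) (T : finType) (A B : T -> T -> R[i]) : T -> T -> R[i] :=
  fun x y => \sum_(z : T) A x z * B z y.
Definition kid (R : realType) (T : finType) : T -> T -> R[i] :=
  fun x y => if x == y then 1 else 0.
Definition kprod (R : realType) (T : finType) (s : seq (T -> T -> R[i])) :=
  foldr (@kmul R T) (@kid R T) s.

Definition R0j (R : realType) (L : nat) (g l : R[i]) (j : 'I_L) :
    fstate L -> fstate L -> R[i] :=
  fun x y =>
    Rent g l x.1 (x.2 j) y.1 (y.2 j) *
    (if [forall k, (k != j) ==> (x.2 k == y.2 k)] then 1 else 0).

Definition K0 (R : realType) (L : nat) (h l : R[i]) : fstate L -> fstate L -> R[i] :=
  fun x y => Kent h l x.1 y.1 * (if x.2 == y.2 then 1 else 0).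

Definition monodromy (R : realType) (L : nat) (g h : R[i]) (mu : 'I_L -> R[i])
    (l : R[i]) : fstate L -> fstate L -> R[i] :=
  kprod ([seq R0j g (l - mu j) j | j <- rev (enum 'I_L)] ++
         [:: K0 h l] ++
         [seq R0j g (l + mu j) j | j <- enum 'I_L]).

Definition opA (R : realType) L g h mu (l : R[i]) : spin L -> spin L -> R[i] :=
  fun s t => @monodromy R L g h mu l (ord0, s) (ord0, t).
Definition opB (R : realType) L g h mu (l : R[i]) : spin L -> spin L -> R[i] :=
  fun s t => @monodromy R L g h mu l (ord0, s) (ord_max, t).
Definition opC (R : realType) L g h mu (l : R[i]) : spin L -> spin L -> R[i] :=
  fun s t => @monodromy R L g h mu l (ord_max, s) (ord0, t).
Definition opD (R : realType) L g h mu (l : R[i]) : spin L -> spin L -> R[i] :=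
  fun s t => @monodromy R L g h mu l (ord_max, s) (ord_max, t).

Definition vac (L : nat) : spin L := [ffun => ord0].

Definition Sn (R : realType) L g h (mu : 'I_L -> R[i]) (xC xB : seq R[i]) : R[i] :=
  kprod ([seq @opC R L g h mu x | x <- rev xC] ++ [seq @opB R L g h mu y | y <- xB])
    (vac L) (vac L).

Definition LamA (R : realType) L (g h : R[i]) (mu : 'I_L -> R[i]) (l : R[i]) : R[i] :=
  wb (h + l) * \prod_(j < L) (wa g (l - mu j) * wa g (l + mu j)).
Definition LamD (R : realType) L (g h : R[i]) (mu : 'I_L -> R[i]) (l : R[i]) : R[i] :=
  - (wb (2%:R * l) / wa g (2%:R * l)) * wa g (l - h) *
  \prod_(j < L) (wb (l - mu j) * wb (l + mu j)).

Definition del_at (T : Type) (k : nat) (s : seq T) : seq T := take k s ++ drop k.+1 s.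

Definition prodZ (R : realType) (g l0 : R[i]) (Z : seq R[i]) : R[i] :=
  \prod_(x <- Z) ((wa g (l0 - x) / wb (l0 - x)) * (wa g (l0 + x + g) / wb (l0 + x + g))).

Definition Mtil (R : realType) L (g h : R[i]) (mu : 'I_L -> R[i]) (l0 : R[i])
    (xC xB : seq R[i]) : R[i] :=
  LamD g h mu l0 * (prodZ g l0 xB - prodZ g l0 xC).

Definition prod1 (R : realType) (g : R[i]) (n : nat) (Z : seq R[i]) (k : 'I_n) : R[i] :=
  \prod_(j < n | j != k)
    ((wa g (nth 0 Z j - nth 0 Z k) / wb (nth 0 Z j - nth 0 Z k)) *
     (wb (nth 0 Z j + nth 0 Z k) / wa g (nth 0 Z j + nth 0 Z k))).
Definition prod2 (R : realType) (g : R[i]) (n : nat) (Z : seq R[i]) (k : 'I_n) : R[i] :=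
  \prod_(j < n | j != k)
    ((wa g (nth 0 Z k - nth 0 Z j) / wb (nth 0 Z k - nth 0 Z j)) *
     (wa g (nth 0 Z k + nth 0 Z j + g) / wb (nth 0 Z k + nth 0 Z j + g))).

Definition Ntil (R : realType) L (g h : R[i]) (mu : 'I_L -> R[i]) (l0 : R[i])
    (n : nat) (Z : seq R[i]) (k : 'I_n) : R[i] :=
  let l := nth 0 Z k in
  LamA g h mu l * (wc g / wa g (2%:R * l0)) * (wb (2%:R * l) / wa g (2%:R * l)) *
    (wa g (2%:R * l0 + g) / wa g (l0 + l)) * prod1 g Z k
  - LamD g h mu l * (wa g (2%:R * l0 + g) / wb (2%:R * l0 + g)) * (wc g / wb (l0 - l)) *
    prod2 g Z k.

Definition NtilC (R : realType) L g h mu l0 n (xC : seq R[i]) (k : 'I_n) : R[i] :=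
  - @Ntil R L g h mu l0 n xC k.
Definition NtilB (R : realType) L g h mu l0 n (xB : seq R[i]) (k : 'I_n) : R[i] :=
  @Ntil R L g h mu l0 n xB k.

(* Main.v *)
Require Import Defs.
From HB Require Import structures.
From mathcomp Require Import all_boot all_order all_algebra.
From mathcomp Require Import complex.
From mathcomp Require Import boolp reals sequences exp trigo.
From mathcomp Require Import ring.
Import Order.TTheory GRing.Theory Num.Theory.
Local Open Scope ring_scope.
Local Open Scope complex_scope.

Set Implicit Arguments.
Unset Strict Implicit.
Unset Printing Implicit Defensive.

(** Put D~(l) = D(l) - (c / a(2l)) A(l), so that A(l) and D~(l) act on the vacuum
    by [LamA] and [LamD]. The identity is obtained by evaluating
      <0| C(xC) D~(l0) B(xB) |0>
    with D~(l0) acting first to the right and then to the left. On B(xB)|0> the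
    off-shell action of D~(l0) follows by induction on the number of B's from the
    exchange relations of the reflection algebra. The left action is the same
    computation: all R- and K-matrices are symmetric, so the transpose of the
    monodromy matrix with inhomogeneities mu is the one with inhomogeneities
    - mu; transposition thus turns C into B, and [LamA], [LamD] are even in mu. *)

(** * Trigonometric identities *)

(** The reflection equation gives relations between A, B and D only up to scalar factors such as a(u
    - v) and b(u + v), which may vanish at points where the identity is claimed. Matrix entries are
    Laurent polynomials in the exponential of the spectral parameter, so a factor that is not
    identically zero can be cancelled; only the true denominators of the off-shell coefficients
    survive as conditions.

    Moving D~ past a B also produces A, so the induction treats both operators as one family indexed
    by [bool]. Contributions to the same exchanged term are merged by a quadratic identity between
    the exchange coefficients, instead of the usual appeal to the symmetry of the Bethe vector.

    In the final comparison the diagonal terms of the two evaluations differ only in their products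
    over X and Y, which gives M_0; the exchanged terms enter with opposite signs. *)

Lemma cexpD (R : realType) (x y : R[i]) : cexp (x + y) = cexp x * cexp y.
Proof.
case: x => a b; case: y => a' b'; rewrite /cexp /= expRD cosD sinD.
by apply/eqP; rewrite eq_complex /=; apply/andP; split; apply/eqP; ring.
Qed.

Lemma cexp0 (R : realType) : cexp (0 : R[i]) = 1.
Proof.
rewrite /cexp /= expR0 cos0 sin0.
by apply/eqP; rewrite eq_complex /=; apply/andP; split; apply/eqP; ring.
Qed.

Lemma cexp_neq0 (R : realType) (x : R[i]) : cexp x != 0.
Proof.
apply/eqP => x0; have := cexpD x (- x).
by rewrite subrr cexp0 x0 mul0r => /eqP; rewrite oner_eq0.
Qed.

Lemma cexpN (R : realType) (x : R[i]) : cexp (- x) = (cexp x)^-1.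
Proof.
by apply: (mulfI (cexp_neq0 x)); rewrite -cexpD subrr cexp0 divff ?cexp_neq0.
Qed.

Lemma cexp2 (R : realType) (x : R[i]) : cexp (2%:R * x) = cexp x ^+ 2.
Proof. by rewrite mulr_natl mulr2n cexpD expr2. Qed.

Lemma csinhE (R : realType) (x : R[i]) :
  csinh x = (cexp x - (cexp x)^-1) / 2%:R.
Proof. by rewrite /csinh cexpN. Qed.

Lemma csinhN (R : realType) (x : R[i]) : csinh (- x) = - csinh x.
Proof. by rewrite /csinh opprK -mulNr opprB. Qed.

Definition sinhE := (csinhE, cexpD, cexpN, cexp2).

(* Rows and columns of [cf2] and the argument of [cf1] are indexed by
   [false] for A and [true] for D~ = D - (c / a(2u)) A. *)
Definition cf1 (R : realType) (g : R[i]) (i : bool) (u v : R[i]) : R[i] :=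
  if i then (wa g (u - v) / wb (u - v)) * (wa g (u + v + g) / wb (u + v + g))
  else (wa g (v - u) / wb (v - u)) * (wb (v + u) / wa g (v + u)).

Definition cf2 (R : realType) (g : R[i]) (i j : bool) (u v : R[i]) : R[i] :=
  match i, j with
  | false, false => wc g / wb (u - v) * (wb (2%:R * v) / wa g (2%:R * v))
  | false, true => - (wc g / wa g (u + v))
  | true, false => wc g / wa g (2%:R * u) * (wb (2%:R * v) / wa g (2%:R * v))
                     * (wa g (2%:R * u + g) / wa g (u + v))
  | true, true => - (wa g (2%:R * u + g) / wb (2%:R * u + g) * (wc g / wb (u - v)))
  end.

(** Since b(x + g) = a(x), these four conditions cover every denominator of [cf1] and [cf2] at [u],
    [v]. *)
Definition cf_ok (R : realType) (g : R[i]) (u v : R[i]) : bool :=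
  [&& wb (u - v) != 0, wa g (u + v) != 0, wa g (2%:R * u) != 0
    & wa g (2%:R * v) != 0].

(** Consistency with the commutation of B(v) and B(w): both sides are the coefficient of B(u) B(v)
    O_j(w) when O_i(u) is moved through B(w) B(v), respectively B(v) B(w). *)
Lemma cf2_eq (R : realType) (g : R[i]) (i j : bool) (u v w : R[i]) :
  cf_ok g u v -> cf_ok g u w -> cf_ok g v w ->
  cf2 g i j u w * cf1 g j w v =
  cf1 g i u v * cf2 g i j u w + \sum_k cf2 g i k u v * cf2 g k j v w.
Proof.
rewrite big_bool /cf_ok => /and4P[uv0 uv1 uu vv] /and4P[uw0 uw1 _ ww] /and4P[vw0 vw1 _ _].

(* Each factor becomes a polynomial in the exponentials over a monomial, so that the hypotheses
   reduce to nonvanishing numerators, in the form in which [field] asks for them. *)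
have shB x y : csinh (x - y) = (cexp x ^+ 2 - cexp y ^+ 2) / (2%:R * cexp x * cexp y).
  by rewrite !sinhE; move: (cexp_neq0 x) (cexp_neq0 y) => x0 y0; field; rewrite x0 y0.
have aD x y : csinh (x + y + g) =
    ((cexp x * cexp y * cexp g) ^+ 2 - 1) / (2%:R * cexp x * cexp y * cexp g).
  rewrite !sinhE; move: (cexp_neq0 x) (cexp_neq0 y) (cexp_neq0 g) => x0 y0 g0.
  by field; rewrite x0 y0 g0.
have a2 x : csinh (2%:R * x + g) =
    ((cexp x * cexp x * cexp g) ^+ 2 - 1) / (2%:R * cexp x * cexp x * cexp g).
  by rewrite -aD mulr_natl mulr2n.
have num0 (x y : R[i]) : x / y != 0 -> x != 0 by apply: contra_neq => ->; rewrite mul0r.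
move: uv0 uv1 uu vv uw0 uw1 ww vw0 vw1; rewrite /cf1 /cf2 /wa /wb /wc !shB !aD !a2.
move=> /num0 H1 /num0 H2 /num0 H3 /num0 H4 /num0 H5 /num0 H6 /num0 H7 /num0 H8 /num0 H9.
move: H1 H2 H3 H4 H5 H6 H7 H8 H9.
move: (cexp_neq0 u) (cexp_neq0 v) (cexp_neq0 w) (cexp_neq0 g); rewrite !sinhE.
move: (cexp u) (cexp v) (cexp w) (cexp g) => U V W G u0 v0 w0 g0.
move=> H1 H2 H3 H4 H5 H6 H7 H8 H9.
have H1' : V ^+ 2 - U ^+ 2 != 0 by rewrite -opprB oppr_eq0.
have H5' : W ^+ 2 - U ^+ 2 != 0 by rewrite -opprB oppr_eq0.
have H8' : W ^+ 2 - V ^+ 2 != 0 by rewrite -opprB oppr_eq0.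
case: i; case: j; rewrite /=; field;
  by rewrite ?u0 ?v0 ?w0 ?g0 ?H1 ?H2 ?H3 ?H4 ?H5 ?H6 ?H7 ?H8 ?H9 ?H1' ?H5' ?H8'.
Qed.

(** * Off-shell action on Bethe vectors *)

Section OffShell.

Context {F : comNzRingType} {V : lmodType F} {P : zmodType} {I : finType}.
Variables (B : P -> {linear V -> V}) (O : I -> P -> V -> V) (vac : V).
Variables (Lam : I -> P -> F) (c1 : I -> P -> P -> F) (c2 : I -> I -> P -> P -> F).
Variables (good : pred P) (ok : rel P).

Definition bethe (Y : seq P) : V := foldr (fun y v => B y v) vac Y.

#[local] Arguments bethe : simpl never.

Lemma bethe_cons y Y : bethe (y :: Y) = B y (bethe Y).
Proof. by []. Qed.

Hypothesis O_vac : forall i u, good u -> O i u vac = Lam i u *: vac.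
Hypothesis ok_good : forall u v, ok u v -> good v.
Hypothesis BB : forall u v w, B u (B v w) = B v (B u w).
Hypothesis OB : forall i u v w, ok u v ->
  O i u (B v w) = c1 i u v *: B v (O i u w) + \sum_j c2 i j u v *: B u (O j v w).
Hypothesis c2_eq : forall i j u v w, ok u v -> ok u w -> ok v w ->
  c2 i j u w * c1 j w v = c1 i u v * c2 i j u w + \sum_k c2 i k u v * c2 k j v w.

(** Induction on [Y], general in [i] and [u]: after passing the head [y], the hypothesis is needed
    both for O_i(u) and for the operators O_j(y) created by the exchange. *)
Lemma offshell_action i u Y : good u -> all (ok u) Y -> pairwise ok Y ->
  O i u (bethe Y) =
    (Lam i u * \prod_(y <- Y) c1 i u y) *: bethe Y +
    \sum_(k < size Y)
      (\sum_j c2 i j u (nth 0 Y k) * Lam j (nth 0 Y k) *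
         \prod_(m < size Y | m != k) c1 j (nth 0 Y k) (nth 0 Y m)) *:
      B u (bethe (del_at k Y)).
Proof.
elim: Y i u => [|y Y IH] i u u_good /=.
  by rewrite big_nil mulr1 big_ord0 addr0 O_vac.
case/andP=> uy uY /andP[yY YY].
have y_good := ok_good uy.
rewrite bethe_cons OB //.
under [X in _ + X = _]eq_bigr => j _ do rewrite IH // linearD linearZZ linear_sum scalerDr scalerA scaler_sumr.
rewrite IH //.
rewrite big_split /= big_cons big_ord_recl /= linearD linearZZ linear_sum /= scalerDr scalerA.
rewrite -addrA; congr (_ + _); first by congr (_ *: _); rewrite mulrCA.
(* The diagonal part of O_j(y) on the tail is the summand k = 0, in which [y] is the deleted
   entry. *)
rewrite addrCA; congr (_ + _).
  rewrite /del_at /= drop0 scaler_suml; apply: eq_bigr => j _; congr (_ *: _).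
  rewrite -mulrA; congr (_ * (_ * _)).
  rewrite [in RHS]big_mkcond big_ord_recl /= mul1r (big_nth 0) big_mkord.
  by apply: eq_bigr.
(* The summand k + 1 collects the exchanged terms from O_i(u) and from all O_j(y); commuting B(y)
   and B(u) puts them on the same vector. *)
rewrite exchange_big scaler_sumr -big_split /=; apply: eq_bigr => k _.
rewrite /bump /= add1n add0n /=.
set z := nth 0 Y k.
have -> : del_at k.+1 (y :: Y) = y :: del_at k Y by [].
rewrite bethe_cons linearZZ scalerA (BB y u).
under [X in _ + X = _]eq_bigr => j _ do rewrite linearZZ scalerA.
rewrite -scaler_suml -scalerDl; congr (_ *: _).
have zY : z \in Y by apply: mem_nth.
have uz : ok u z by move/allP: uY; apply.
have yz : ok y z by move/allP: yY; apply.
rewrite mulr_sumr.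
(* The factor [c1 j z y] is the part of the product that comes from the head [y]; isolating it makes
   [c2_eq] applicable. *)
transitivity (\sum_j (c2 i j u z * c1 j z y) * (Lam j z *
   \prod_(m < size Y | m != k) c1 j z (nth 0 Y m))); last first.
  apply: eq_bigr => j _; rewrite -!mulrA; congr (_ * _).
  rewrite mulrCA; congr (_ * _).
  rewrite [in RHS]big_mkcond big_ord_recl /=; congr (_ * _).
  by rewrite big_mkcond; apply: eq_bigr => m _; rewrite /= (inj_eq lift_inj).
under [RHS]eq_bigr => j _ do rewrite (c2_eq i j uy uz yz) mulrDl mulr_suml.
rewrite big_split /=; congr (_ + _); first by apply: eq_bigr => j _; rewrite !mulrA.
rewrite exchange_big; apply: eq_bigr => j _; rewrite mulr_sumr.
by apply: eq_bigr => j' _; rewrite !mulrA.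
Qed.

End OffShell.

(** * The reflection equation for the monodromy matrix *)

Lemma ord2P (a : 'I_2) : a = ord0 \/ a = ord_max.
Proof.
by case: a => [[|[|//]]] p; [left | right]; apply: val_inj.
Qed.

Lemma sum_ord2 (V : nmodType) (F : 'I_2 -> V) :
  \sum_a F a = F ord0 + F ord_max.
Proof.
by rewrite big_ord_recl big_ord1; congr (_ + F _); apply: val_inj.
Qed.

(** * Matrices as kernels, their products and transposes *)

Section Kernels.
Context {R : realType}.

Definition kapp (T : finType) (A : T -> T -> R[i]) (f : T -> R[i]) : T -> R[i] :=
  fun x => \sum_y A x y * f y.

Lemma kapp_kmul (T : finType) (A B : T -> T -> R[i]) f :
  kapp (kmul A B) f = kapp A (kapp B f).
Proof.
apply/funext => x; rewrite /kapp /kmul.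
under eq_bigr => y _ do rewrite mulr_suml.
rewrite exchange_big; apply: eq_bigr => z _ /=.
by rewrite mulr_sumr; apply: eq_bigr => y _; rewrite mulrA.
Qed.

Lemma kapp_kid (T : finType) (f : T -> R[i]) : kapp (@kid R T) f = f.
Proof.
apply/funext => x; rewrite /kapp /kid (bigD1 x) //= eqxx mul1r big1 ?addr0 //.
by move=> y; rewrite eq_sym => /negPf ->; rewrite mul0r.
Qed.

Lemma kapp_cat (T : finType) (s1 s2 : seq (T -> T -> R[i])) f :
  kapp (kprod (s1 ++ s2)) f = kapp (kprod s1) (kapp (kprod s2) f).
Proof.
elim: s1 f => [|A s1 IH] f /=; first by rewrite kapp_kid.
by rewrite !kapp_kmul IH.
Qed.

Lemma kapp_delta (T : finType) (A : T -> T -> R[i]) x y :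
  kapp A (fun z => if z == y then 1 else 0) x = A x y.
Proof.
rewrite /kapp (bigD1 y) //= eqxx mulr1 big1 ?addr0 //.
by move=> z /negPf ->; rewrite mulr0.
Qed.

Lemma kapp_inj (T : finType) (A B : T -> T -> R[i]) : kapp A = kapp B -> A = B.
Proof.
move=> AB; apply/funext => x; apply/funext => y.
by rewrite -(kapp_delta A) AB kapp_delta.
Qed.

Lemma kprod_cat (T : finType) (s1 s2 : seq (T -> T -> R[i])) :
  kprod (s1 ++ s2) = kmul (kprod s1) (kprod s2).
Proof. by apply: kapp_inj; apply/funext => f; rewrite kapp_cat kapp_kmul. Qed.

Lemma kprod1 (T : finType) (A : T -> T -> R[i]) : kprod [:: A] = A.
Proof. by apply: kapp_inj; apply/funext => f; rewrite kapp_kmul kapp_kid. Qed.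

Definition ktr (T : finType) (A : T -> T -> R[i]) : T -> T -> R[i] := fun x y => A y x.

Lemma ktr_kprod (T : finType) (s : seq (T -> T -> R[i])) :
  ktr (kprod s) = kprod (rev [seq ktr A | A <- s]).
Proof.
elim: s => [|A s IH] /=.
  by apply/funext => x; apply/funext => y; rewrite /ktr /kid eq_sym.
rewrite rev_cons -cats1 kprod_cat -IH kprod1.
by apply/funext => x; apply/funext => y; apply: eq_bigr => z _; rewrite mulrC.
Qed.

End Kernels.

(** * Site operators, the Yang-Baxter equation and dressing *)

Section Sites.
Context {R : realType} {L : nat} (g h : R[i]).

Definition upd (s : spin L) (j : 'I_L) (b : 'I_2) : spin L :=
  [ffun k => if k == j then b else s k].

Lemma upd_same s j b : upd s j b j = b. Proof. by rewrite ffunE eqxx. Qed.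
Lemma upd_other s j b k : k != j -> upd s j b k = s k.
Proof. by rewrite ffunE => /negPf ->. Qed.
Lemma upd_upd s j b b' : upd (upd s j b) j b' = upd s j b'.
Proof. by apply/ffunP => k; rewrite !ffunE; case: eqP. Qed.
Lemma upd_id s j : upd s j (s j) = s.
Proof. by apply/ffunP => k; rewrite ffunE; case: eqP => [->|]. Qed.
Lemma updC s j k b b' : j != k -> upd (upd s j b) k b' = upd (upd s k b') j b.
Proof.
move=> jk; apply/ffunP => m; rewrite !ffunE.
by case: (eqVneq m k) => // ->; rewrite eq_sym (negPf jk).
Qed.

Definition wave := 'I_2 -> spin L -> R[i].

(** The weight c exchanges the auxiliary spin with the spin at [j], whence the argument
    [f (s j) (upd s j a)]. *)
Definition rop (u : R[i]) (j : 'I_L) (f : wave) : wave := fun a s =>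
  if a == s j then wa g u * f a s else wb u * f a s + wc g * f (s j) (upd s j a).

Definition kop (u : R[i]) (f : wave) : wave := fun a s => Kent h u a a * f a s.

Definition uncurry_wave (f : wave) : fstate L -> R[i] := fun x => f x.1 x.2.

Lemma kapp_R0j u j (f : wave) :
  kapp (R0j g u j) (uncurry_wave f) = uncurry_wave (rop u j f).
Proof.
apply/funext => -[a s]; rewrite /kapp /uncurry_wave /R0j /= -(pair_bigA _ (fun (b : 'I_2) (t : spin L) =>
  Rent g u a (s j) b (t j) * (if [forall k, (k != j) ==> (s k == t k)] then 1 else 0) * f b t)) /=.
have sumt b : \sum_(t : spin L) Rent g u a (s j) b (t j) *
   (if [forall k, (k != j) ==> (s k == t k)] then 1 else 0) * f b t =
   \sum_(i : 'I_2) Rent g u a (s j) b i * f b (upd s j i).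
  rewrite (bigID (fun t : spin L => [forall k, (k != j) ==> (s k == t k)])) /=.
  rewrite [X in _ + X]big1 ?addr0; last by move=> t /negPf ->; rewrite mulr0 mul0r.
  rewrite (reindex_onto (fun i : 'I_2 => upd s j i) (fun t : spin L => t j)) /=; last first.
    move=> t /forallP st; apply/ffunP => k; rewrite ffunE.
    by have := st k; case: (eqVneq k j) => [-> //|_ /= /eqP].
  apply: eq_big => [i|i /andP[-> _]]; last by rewrite upd_same mulr1.
  rewrite upd_same eqxx andbT; apply/forallP => k; apply/implyP => kj.
  by rewrite upd_other.
rewrite sum_ord2 !sumt !sum_ord2 /rop.
move: (upd_id s j).
case: (ord2P a) => ->; case: (ord2P (s j)) => -> /= E; rewrite /Rent /= ?E; ring.
Qed.

Lemma kapp_K0 u (f : wave) :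
  kapp (K0 h u) (uncurry_wave f) = uncurry_wave (kop u f).
Proof.
apply/funext => -[a s]; rewrite /kapp /uncurry_wave /K0 /kop /=.
rewrite (bigD1 (a, s)) //= eqxx mulr1 big1 ?addr0 //.
move=> [b t]; rewrite /Kent xpair_eqE negb_and /= (eq_sym a) (eq_sym s).
by case: (b == a); case: (t == s); rewrite //= ?mul0r ?mulr0 ?mul0r.
Qed.

Definition wave2 := 'I_2 -> 'I_2 -> spin L -> R[i].

(** There are two auxiliary spaces over one quantum space; [lift1] and [lift2] let an operator act
    on the first or the second of them, and [r12] is the R-matrix between the two. *)
Definition lift1 (O : wave -> wave) (f : wave2) : wave2 :=
  fun a b s => O (fun a' s' => f a' b s') a s.
Definition lift2 (O : wave -> wave) (f : wave2) : wave2 :=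
  fun a b s => O (fun b' s' => f a b' s') b s.
Definition r12 (u : R[i]) (f : wave2) : wave2 := fun a b s =>
  if a == b then wa g u * f a b s else wb u * f a b s + wc g * f b a s.

Lemma wave2_ext (f f' : wave2) : (forall a b s, f a b s = f' a b s) -> f = f'.
Proof. by move=> E; apply/funext => a; apply/funext => b; apply/funext => s. Qed.

Lemma YBE_diff x y j f :
  r12 (x - y) (lift1 (rop x j) (lift2 (rop y j) f)) =
  lift2 (rop y j) (lift1 (rop x j) (r12 (x - y) f)).
Proof.
apply: wave2_ext => a b s.
(* Writing [s] as [upd s j (s j)] brings every value of [f] to the form [f _ _ (upd s j _)], which
   leaves a finite check on three spins. *)
rewrite /r12 /lift1 /lift2 /rop -(upd_id s j) !upd_same !upd_upd.
move: (cexp_neq0 x) (cexp_neq0 y) (cexp_neq0 g).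
case: (ord2P a) => ->; case: (ord2P b) => ->; case: (ord2P (s j)) => -> /=;
  rewrite ?upd_same ?upd_upd /= /wa /wb /wc ?sinhE => x0 y0 g0;
  by [ring | field; rewrite ?x0 ?y0 ?g0].
Qed.

(** The same Yang-Baxter equation with site [j] as the middle one of the three spaces, at arguments
    x, x + y and y. *)
Lemma YBE_sum x y j f :
  lift1 (rop x j) (r12 (x + y) (lift2 (rop y j) f)) =
  lift2 (rop y j) (r12 (x + y) (lift1 (rop x j) f)).
Proof.
apply: wave2_ext => a b s.
rewrite /r12 /lift1 /lift2 /rop -(upd_id s j) !upd_same !upd_upd.
move: (cexp_neq0 x) (cexp_neq0 y) (cexp_neq0 g).
case: (ord2P a) => ->; case: (ord2P b) => ->; case: (ord2P (s j)) => -> /=;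
  rewrite ?upd_same ?upd_upd /= /wa /wb /wc ?sinhE => x0 y0 g0;
  by [ring | field; rewrite ?x0 ?y0 ?g0].
Qed.

Lemma RE_kop x y f :
  r12 (x - y) (lift1 (kop x) (r12 (x + y) (lift2 (kop y) f))) =
  lift2 (kop y) (r12 (x + y) (lift1 (kop x) (r12 (x - y) f))).
Proof.
apply: wave2_ext => a b s; rewrite /r12 /lift1 /lift2 /kop.
move: (cexp_neq0 x) (cexp_neq0 y) (cexp_neq0 g) (cexp_neq0 h).
case: (ord2P a) => ->; case: (ord2P b) => -> /=;
  rewrite /Kent /= /wa /wb /wc ?sinhE => x0 y0 g0 h0;
  by [ring | field; rewrite ?x0 ?y0 ?g0 ?h0].
Qed.

Lemma rop_rop_comm x y j k f : j != k ->
  lift1 (rop x j) (lift2 (rop y k) f) = lift2 (rop y k) (lift1 (rop x j) f).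
Proof.
move=> jk; apply: wave2_ext => a b s; rewrite /lift1 /lift2 /rop.
have kj : k != j by rewrite eq_sym.
rewrite !(upd_other _ _ jk) !(upd_other _ _ kj) (updC _ _ _ jk).
by case: (a == s j); case: (b == s k); ring.
Qed.

Lemma rop_kop_comm x y j f :
  lift1 (rop x j) (lift2 (kop y) f) = lift2 (kop y) (lift1 (rop x j) f).
Proof.
apply: wave2_ext => a b s; rewrite /lift1 /lift2 /rop /kop.
by case: (a == s j); ring.
Qed.

Lemma kop_rop_comm x y j f :
  lift1 (kop x) (lift2 (rop y j) f) = lift2 (rop y j) (lift1 (kop x) f).
Proof.
apply: wave2_ext => a b s; rewrite /lift1 /lift2 /rop /kop.
by case: (b == s j); ring.
Qed.

Variable mu : 'I_L -> R[i].

(* The double-row monodromy built outwards from K, the head of the list being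
   the outermost site. *)
Fixpoint dressed (js : seq 'I_L) (u : R[i]) : wave -> wave :=
  if js is j :: js' then
    fun f => rop (u - mu j) j (dressed js' u (rop (u + mu j) j f))
  else kop u.

Lemma dressed_rop_comm js u y k f : k \notin js ->
  lift1 (dressed js u) (lift2 (rop y k) f) = lift2 (rop y k) (lift1 (dressed js u) f).
Proof.
elim: js f => [|j js IH] f /=; first by rewrite kop_rop_comm.
rewrite inE negb_or => /andP[kj kjs].
have jk : j != k by rewrite eq_sym.
transitivity (lift1 (rop (u - mu j) j) (lift1 (dressed js u)
  (lift1 (rop (u + mu j) j) (lift2 (rop y k) f)))) => //.
by rewrite (rop_rop_comm _ _ _ jk) IH // (rop_rop_comm _ _ _ jk).
Qed.

Lemma rop_dressed_comm js u x k f : k \notin js ->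
  lift1 (rop x k) (lift2 (dressed js u) f) = lift2 (dressed js u) (lift1 (rop x k) f).
Proof.
elim: js f => [|j js IH] f /=; first by rewrite rop_kop_comm.
rewrite inE negb_or => /andP[kj kjs].
transitivity (lift1 (rop x k) (lift2 (rop (u - mu j) j) (lift2 (dressed js u)
  (lift2 (rop (u + mu j) j) f)))) => //.
by rewrite (rop_rop_comm _ _ _ kj) IH // (rop_rop_comm _ _ _ kj).
Qed.

(** Sklyanin's dressing argument: in the sums and differences of the shifted arguments [mu j]
    cancels, so the Yang-Baxter equation moves the factors of the outer site past [r12] at u + v and
    u - v, and the inner operators satisfy the equation by induction. *)
Lemma reflection_equation js u v f : uniq js ->
  r12 (u - v) (lift1 (dressed js u) (r12 (u + v) (lift2 (dressed js v) f))) =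
  lift2 (dressed js v) (r12 (u + v) (lift1 (dressed js u) (r12 (u - v) f))).
Proof.
elim: js f => [|j js IH] f; first by move=> _; rewrite RE_kop.
case/andP=> jjs js_uniq.
have lift1E f' : lift1 (dressed (j :: js) u) f' = lift1 (rop (u - mu j) j)
  (lift1 (dressed js u) (lift1 (rop (u + mu j) j) f')) by [].
have lift2E f' : lift2 (dressed (j :: js) v) f' = lift2 (rop (v - mu j) j)
  (lift2 (dressed js v) (lift2 (rop (v + mu j) j) f')) by [].
have sumE x y : x + mu j + (y - mu j) = x + y by ring.
have sumE' x y : x - mu j + (y + mu j) = x + y by ring.
have difE x y : x + mu j - (y + mu j) = x - y by ring.
have difE' x y : x - mu j - (y - mu j) = x - y by ring.
rewrite !lift1E !lift2E.
rewrite -{1}(sumE u v) YBE_sum sumE dressed_rop_comm // rop_dressed_comm //.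
rewrite -{1}(difE' u v) YBE_diff difE' IH //.
rewrite -{1}(difE u v) YBE_diff difE.
rewrite dressed_rop_comm // rop_dressed_comm //.
by rewrite -{1}(sumE' u v) YBE_sum sumE'.
Qed.

Lemma kapp_monodromy u (f : wave) :
  kapp (monodromy g h mu u) (uncurry_wave f) =
  uncurry_wave (dressed (rev (enum 'I_L)) u f).
Proof.
(* Appending a site to the list adds the outermost factor on both sides of the product, hence
   induction from the end. *)
rewrite /monodromy; elim/last_ind: (enum 'I_L) f => [|js j IH] f.
  by rewrite kapp_cat /= kapp_kid kapp_kmul kapp_kid kapp_K0.
rewrite rev_rcons map_cons map_rcons -cats1 !catA kapp_cat kprod1 kapp_R0j -catA.
rewrite cat_cons [kprod (_ :: _)]/= kapp_kmul IH kapp_R0j.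
by [].
Qed.

End Sites.

(** * Exchange relations *)

(** The regular module [R[i]^o] makes these functions a left module over [R[i]], as the off-shell
    section requires. *)
Notation qvec R L := {ffun spin L -> R[i]^o}.

Definition act (R : realType) L (K : spin L -> spin L -> R[i]) (v : qvec R L) : qvec R L :=
  [ffun s => \sum_t K s t * v t].

Lemma act_is_linear (R : realType) L (K : spin L -> spin L -> R[i]) : linear (act K).
Proof.
move=> k v w; apply/ffunP => s; rewrite !ffunE scaler_sumr -big_split.
by apply: eq_bigr => t _; rewrite !ffunE mulrDr mulrCA.
Qed.

HB.instance Definition _ (R : realType) L (K : spin L -> spin L -> R[i]) :=
  GRing.isLinear.Build R[i] (qvec R L) (qvec R L) *:%R (act K) (act_is_linear K).

(** * Matrix entries of the reflection equation *)

Section Components.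
Context {F : comNzRingType} {V : lmodType F}.
Implicit Types (f : 'I_2 -> 'I_2 -> V) (X Y : 'I_2 -> 'I_2 -> V -> V).

Definition vR12 (a b c : F) f : 'I_2 -> 'I_2 -> V := fun i j =>
  if i == j then a *: f i j else b *: f i j + c *: f j i.
Definition vT1 X f : 'I_2 -> 'I_2 -> V := fun i j => \sum_i' X i i' (f i' j).
Definition vT2 X f : 'I_2 -> 'I_2 -> V := fun i j => \sum_j' X j j' (f i j').

Lemma vR12_diag a b c f i : vR12 a b c f i i = a *: f i i.
Proof. by rewrite /vR12 eqxx. Qed.
Lemma vR12_01 a b c f :
  vR12 a b c f ord0 ord_max = b *: f ord0 ord_max + c *: f ord_max ord0.
Proof. by []. Qed.
Lemma vR12_10 a b c f :
  vR12 a b c f ord_max ord0 = b *: f ord_max ord0 + c *: f ord0 ord_max.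
Proof. by []. Qed.
Lemma vT1E X f i j :
  vT1 X f i j = X i ord0 (f ord0 j) + X i ord_max (f ord_max j).
Proof. exact: sum_ord2. Qed.
Lemma vT2E X f i j :
  vT2 X f i j = X j ord0 (f i ord0) + X j ord_max (f i ord_max).
Proof. exact: sum_ord2. Qed.

Definition table (p00 p01 p10 p11 : V) : 'I_2 -> 'I_2 -> V := fun i j =>
  if i == ord0 then (if j == ord0 then p00 else p01) else (if j == ord0 then p10 else p11).

Lemma table00 p00 p01 p10 p11 : table p00 p01 p10 p11 ord0 ord0 = p00. Proof. by []. Qed.
Lemma table01 p00 p01 p10 p11 : table p00 p01 p10 p11 ord0 ord_max = p01. Proof. by []. Qed.
Lemma table10 p00 p01 p10 p11 : table p00 p01 p10 p11 ord_max ord0 = p10. Proof. by []. Qed.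
Lemma table11 p00 p01 p10 p11 : table p00 p01 p10 p11 ord_max ord_max = p11. Proof. by []. Qed.

Definition componentE := (vR12_diag, vR12_01, vR12_10, vT1E, vT2E,
  table00, table01, table10, table11).

(* [am], [bm] are the weights at [u - v], and [ap], [bp] those at [u + v]. *)
Variables (am bm ap bp c : F) (X Y : 'I_2 -> 'I_2 -> V -> V).
Hypothesis RE : forall f,
  vR12 am bm c (vT1 X (vR12 ap bp c (vT2 Y f))) =
  vT2 Y (vR12 ap bp c (vT1 X (vR12 am bm c f))).

Local Notation XA := (X ord0 ord0).
Local Notation XB := (X ord0 ord_max).
Local Notation XD := (X ord_max ord_max).
Local Notation YA := (Y ord0 ord0).
Local Notation YB := (Y ord0 ord_max).
Local Notation YD := (Y ord_max ord_max).

Hypotheses (X_lin : forall i j, linear (X i j)) (Y_lin : forall i j, linear (Y i j)).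

Let opD (Z : V -> V) : linear Z -> forall v w, Z (v + w) = Z v + Z w.
Proof. by move=> Zl v w; have := Zl 1 v w; rewrite !scale1r. Qed.
Let op0 (Z : V -> V) : linear Z -> Z 0 = 0.
Proof. by move=> Zl; apply: (addrI (Z 0)); rewrite -opD // !addr0. Qed.
Let opZ (Z : V -> V) : linear Z -> forall k v, Z (k *: v) = k *: Z v.
Proof. by move=> Zl k v; have := Zl k v 0; rewrite !addr0 op0 // addr0. Qed.

(* Matching against a variable [o] instead of [0] keeps the unifier from
   unfolding the vectors it is compared with. *)
Let zeroE (o : V) : o = 0 ->
  ((forall i j, X i j o = o) * (forall i j, Y i j o = o) *
   (forall k : F, (k *: o = o)%R) *
   (forall v, (o + v = v)%R) * (forall v, (v + o = v)%R))%type.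
Proof.
move=> ->; split; first split; first split; first split.
- by move=> i j; rewrite op0.
- by move=> i j; rewrite op0.
- exact: scaler0.
- exact: add0r.
- exact: addr0.
Qed.

Let linE :
  ((forall i j v w, X i j (v + w)%R = (X i j v + X i j w)%R) *
   (forall i j v w, Y i j (v + w)%R = (Y i j v + Y i j w)%R) *
   (forall i j k v, X i j (k *: v)%R = (k *: X i j v)%R) *
   (forall i j k v, Y i j (k *: v)%R = (k *: Y i j v)%R))%type.
Proof. by do ![split] => *; rewrite ?opD ?opZ. Qed.

(** Evaluating the equation on a table with one nonzero entry and reading one component isolates one
    matrix entry, here from (1,1) to (0,0). The next two relations use (1,0) to (0,0) and (1,1) to
    (1,0). *)
Lemma RE_BB w : (am * bp) *: XB (YB w) = (am * bp) *: YB (XB w).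
Proof.
have [o o0] : exists o : V, o = 0 by exists 0.
have /(congr1 (fun G => G ord0 ord0)) := RE (table o o o w).
rewrite !componentE.
rewrite !(zeroE o0) !linE !scalerA => ->.
by rewrite mulrC.
Qed.

Lemma RE_BA w :
  (am * bp) *: XB (YA w) =
  (ap * bm) *: YA (XB w) + (bp * c) *: YB (XA w) + (c * bm) *: YB (XD w).
Proof.
have [o o0] : exists o : V, o = 0 by exists 0.
have /(congr1 (fun G => G ord0 ord0)) := RE (table o o w o).
rewrite !componentE.
rewrite !(zeroE o0) !linE !(scalerDr, scalerA).
by rewrite addrA.
Qed.

Lemma RE_DB w :
  (bm * bp) *: XD (YB w) + (c * c) *: XA (YB w) + (c * ap) *: XB (YD w) =
  (am * c) *: YA (XB w) + (am * ap) *: YB (XD w).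
Proof.
have [o o0] : exists o : V, o = 0 by exists 0.
have /(congr1 (fun G => G ord_max ord0)) := RE (table o o o w).
rewrite !componentE.
rewrite !(zeroE o0) !linE !(scalerDr, scalerA) => E.
rewrite -addrA E; congr (_ + _); congr (_ *: _); exact: mulrC.
Qed.

End Components.

Section Relations.
Context {R : realType} {L : nat} (g h : R[i]) (mu : 'I_L -> R[i]).

Definition mono (a a' : 'I_2) (u : R[i]) (s t : spin L) : R[i] :=
  monodromy g h mu u (a, s) (a', t).

Lemma dressedE u (f : wave) a s :
  dressed g h mu (rev (enum 'I_L)) u f a s = \sum_a' \sum_t mono a a' u s t * f a' t.
Proof.
have /(congr1 (@^~ (a, s))) := kapp_monodromy g h mu u f.
rewrite /kapp /uncurry_wave /= => <-.
rewrite (pair_bigA _ (fun b t => mono a b u s t * f b t)).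
by apply: eq_bigr => -[b t] _.
Qed.

Definition wave_of (f : 'I_2 -> 'I_2 -> qvec R L) : wave2 := fun a b s => f a b s.

Definition monoT (u : R[i]) : 'I_2 -> 'I_2 -> qvec R L -> qvec R L :=
  fun a a' => act (mono a a' u).

Lemma lift1_wave_of u f :
  lift1 (dressed g h mu (rev (enum 'I_L)) u) (wave_of f) = wave_of (vT1 (monoT u) f).
Proof.
apply: wave2_ext => a b s; rewrite /lift1 dressedE /wave_of /vT1 sum_ffunE.
by apply: eq_bigr => a' _; rewrite ffunE.
Qed.

Lemma lift2_wave_of u f :
  lift2 (dressed g h mu (rev (enum 'I_L)) u) (wave_of f) = wave_of (vT2 (monoT u) f).
Proof.
apply: wave2_ext => a b s; rewrite /lift2 dressedE /wave_of /vT2 sum_ffunE.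
by apply: eq_bigr => a' _; rewrite ffunE.
Qed.

Lemma r12_wave_of u f :
  r12 g u (wave_of f) = wave_of (vR12 (wa g u) (wb u) (wc g) f).
Proof.
apply: wave2_ext => a b s; rewrite /r12 /wave_of /vR12.
by case: eqP => _; rewrite !ffunE.
Qed.

Lemma monoT_reflection u v f :
  vR12 (wa g (u - v)) (wb (u - v)) (wc g)
    (vT1 (monoT u) (vR12 (wa g (u + v)) (wb (u + v)) (wc g) (vT2 (monoT v) f))) =
  vT2 (monoT v) (vR12 (wa g (u + v)) (wb (u + v)) (wc g)
    (vT1 (monoT u) (vR12 (wa g (u - v)) (wb (u - v)) (wc g) f))).
Proof.
apply/funext => a; apply/funext => b; apply/ffunP => s.
have := reflection_equation g h mu u v (wave_of f) (js := rev (enum 'I_L)).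
rewrite rev_uniq enum_uniq !(lift2_wave_of, r12_wave_of, lift1_wave_of) => /(_ isT).
by move/(congr1 (fun F => F a b s)).
Qed.

Lemma monoT_linear u a a' : linear (monoT u a a').
Proof. exact: act_is_linear. Qed.

Local Notation A u := (act (opA g h mu u)).
Local Notation B u := (act (opB g h mu u)).
Local Notation D u := (act (opD g h mu u)).

Lemma rel_BB u v w :
  (wa g (u - v) * wb (u + v)) *: B u (B v w) = (wa g (u - v) * wb (u + v)) *: B v (B u w).
Proof. exact: (RE_BB (monoT_reflection u v) (monoT_linear u) (monoT_linear v)). Qed.

Lemma rel_BA u v w :
  (wa g (u - v) * wb (u + v)) *: B u (A v w) =
  (wa g (u + v) * wb (u - v)) *: A v (B u w) + (wb (u + v) * wc g) *: B v (A u w)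
    + (wc g * wb (u - v)) *: B v (D u w).
Proof. exact: (RE_BA (monoT_reflection u v) (monoT_linear u) (monoT_linear v)). Qed.

Lemma rel_DB u v w :
  (wb (u - v) * wb (u + v)) *: D u (B v w) + (wc g * wc g) *: A u (B v w)
    + (wc g * wa g (u + v)) *: B u (D v w) =
  (wa g (u - v) * wc g) *: A v (B u w) + (wa g (u - v) * wa g (u + v)) *: B v (D u w).
Proof. exact: (RE_DB (monoT_reflection u v) (monoT_linear u) (monoT_linear v)). Qed.

End Relations.

(** * Cancelling factors that are not identically zero *)

Section Laurent.
Context {R : realType}.
Implicit Types (f k : R[i] -> R[i]).

(** Laurent polynomials in the exponential of [v], with the negative powers cleared by [N]. *)
Definition laurent f :=
  exists N (p : {poly R[i]}), forall v, cexp v ^+ N * f v = p.[cexp v].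

Lemma laurent_const (x : R[i]) : laurent (fun=> x).
Proof. by exists 0%N, x%:P => v; rewrite mul1r hornerC. Qed.

Lemma laurent_cexp : laurent (@cexp R).
Proof. by exists 0%N, 'X => v; rewrite mul1r hornerX. Qed.

Lemma laurent_cexpN : laurent (fun v : R[i] => cexp (- v)).
Proof. by exists 1%N, 1 => v; rewrite expr1 hornerC cexpN divff ?cexp_neq0. Qed.

Lemma laurentM f k : laurent f -> laurent k -> laurent (fun v => f v * k v).
Proof.
move=> [N [p fp]] [M [q kq]]; exists (N + M)%N, (p * q) => v.
by rewrite hornerM -fp -kq exprD mulrACA.
Qed.

Lemma laurentD f k : laurent f -> laurent k -> laurent (fun v => f v + k v).
Proof.
move=> [N [p fp]] [M [q kq]]; exists (N + M)%N, ('X^M * p + 'X^N * q) => v.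
by rewrite hornerD !hornerM !hornerXn -fp -kq exprD; ring.
Qed.

Lemma laurentN f : laurent f -> laurent (fun v => - f v).
Proof.
move=> [N [p fp]]; exists N, (- p) => v.
by rewrite hornerN -fp mulrN.
Qed.

Lemma laurent_sum (T : finType) (F : T -> R[i] -> R[i]) :
  (forall t, laurent (F t)) -> laurent (fun v => \sum_t F t v).
Proof.
move=> lF; elim: (index_enum T) => [|t s IH].
  suff -> : (fun v => \sum_(i <- [::]) F i v) = fun=> 0 by apply: laurent_const.
  by apply/funext => v; rewrite big_nil.
suff -> : (fun v => \sum_(i <- t :: s) F i v) =
  (fun v => F t v + \sum_(i <- s) F i v) by apply: laurentD.
by apply/funext => v; rewrite big_cons.
Qed.

Definition laurent_exponent f :=
  laurent (fun v => cexp (f v)) /\ laurent (fun v => cexp (- f v)).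

Lemma exponent_id : laurent_exponent id.
Proof. by split; [exact: laurent_cexp | exact: laurent_cexpN]. Qed.

Lemma exponent_const x : laurent_exponent (fun=> x).
Proof. by split; exact: laurent_const. Qed.

Lemma exponentD f k :
  laurent_exponent f -> laurent_exponent k -> laurent_exponent (fun v => f v + k v).
Proof.
move=> [f1 f2] [k1 k2]; split.
  by under eq_fun => v do rewrite cexpD; apply: laurentM.
by under eq_fun => v do rewrite opprD cexpD; apply: laurentM.
Qed.

Lemma exponentN f : laurent_exponent f -> laurent_exponent (fun v => - f v).
Proof.
by move=> [f1 f2]; split => //; under eq_fun => v do rewrite opprK.
Qed.

Lemma exponent2 f : laurent_exponent f -> laurent_exponent (fun v => 2%:R * f v).
Proof.
by move=> ef; under eq_fun => v do rewrite mulr_natl mulr2n; apply: exponentD.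
Qed.

Lemma laurent_csinh f : laurent_exponent f -> laurent (fun v => csinh (f v)).
Proof.
move=> [f1 f2]; apply: laurentM; last exact: laurent_const.
by apply: laurentD => //; apply: laurentN.
Qed.

Definition cexp_nat (n : nat) : R[i] := cexp (n%:R)%:C.

Lemma cexp_nat_inj : injective cexp_nat.
Proof.
move=> m n; rewrite /cexp_nat /cexp /= cos0 sin0 => /(congr1 (@complex.Re R)) /=.
rewrite !mulr1 !mul0r !subr0 => /expR_inj /eqP.
by rewrite eqr_nat => /eqP.
Qed.

(** Polynomials over a field have no zero divisors, and one that vanishes at infinitely many points
    is zero; the exponentials of the natural numbers provide the points. *)
Lemma laurent_cancel f k : laurent f -> laurent k -> (exists v, k v != 0) ->
  (forall v, k v * f v = 0) -> forall v, f v = 0.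
Proof.
move=> [N [p fp]] [M [q kq]] [v0 kv0] kf v.
have q0 : q != 0.
  apply: contraNneq kv0 => q0; have := kq v0; rewrite q0 horner0 => /eqP.
  by rewrite mulf_eq0 expf_eq0 (negPf (cexp_neq0 _)) andbF.
suff p0 : p = 0.
  have := fp v; rewrite p0 horner0 => /eqP.
  by rewrite mulf_eq0 expf_eq0 (negPf (cexp_neq0 _)) andbF => /eqP.
apply/eqP; rewrite -(mulIr_eq0 _ (mulIf q0)); apply/negP => /negP pq0.
(* A nonzero polynomial has fewer distinct roots than its size, so this many roots are one too
   many. *)
have := max_poly_roots (rs := [seq cexp_nat n | n <- iota 0 (size (p * q))]) pq0.
rewrite size_map size_iota ltnn (map_inj_uniq cexp_nat_inj) iota_uniq => /(_ _ isT).
suff -> : all (root (p * q)) [seq cexp_nat n | n <- iota 0 (size (p * q))] by move=> /(_ isT).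
apply/allP => _ /mapP[n _ ->]; rewrite /root hornerM -fp -kq.
by rewrite mulrACA (mulrC (f _)) kf mulr0.
Qed.

Lemma csinh_neq0 : exists x : R[i], csinh x != 0.
Proof.
exists 1%:C; apply/eqP; rewrite csinhE => /eqP.
rewrite mulf_eq0 invr_eq0 pnatr_eq0 orbF subr_eq0 => /eqP E.
(* If sinh 1 vanished, the exponentials of 1 and -1 would agree, and that of 2 would be 1. *)
suff /cexp_nat_inj : cexp_nat 2 = cexp_nat 0 by [].
rewrite /cexp_nat cexp0.
have -> : (2%:R%:C : R[i]) = 1%:C + 1%:C by rewrite -raddfD.
by rewrite cexpD {1}E mulVf ?cexp_neq0.
Qed.

End Laurent.

(** * Exchange relations with the spurious factors removed *)

Section Exchange.
Context {R : realType} {L : nat} (g h : R[i]) (mu : 'I_L -> R[i]).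

Definition klaurent (T : finType) (K : R[i] -> T -> T -> R[i]) :=
  forall x y, laurent (fun u => K u x y).

Lemma klaurent_kmul (T : finType) (K K' : R[i] -> T -> T -> R[i]) :
  klaurent K -> klaurent K' -> klaurent (fun u => kmul (K u) (K' u)).
Proof. by move=> lK lK' x y; apply: laurent_sum => z; apply: laurentM. Qed.

Lemma klaurent_kprod (T : finType) (I : Type) (K : R[i] -> I -> T -> T -> R[i]) s :
  (forall i, klaurent (fun u => K u i)) ->
  klaurent (fun u => kprod [seq K u i | i <- s]).
Proof.
move=> lK; elim: s => [|i s IH] /=; last exact: klaurent_kmul.
by move=> x y; apply: laurent_const.
Qed.

Lemma klaurent_R0j f (j : 'I_L) : laurent_exponent f ->
  klaurent (fun u => R0j g (f u) j).
Proof.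
move=> ef x y; apply: laurentM; last exact: laurent_const.
rewrite /Rent; case: (_ && _); last by case: (_ || _); apply: laurent_const.
case: (x.1 == x.2 j); last exact: laurent_csinh.
exact: laurent_csinh (exponentD ef (exponent_const g)).
Qed.

Lemma klaurent_K0 : klaurent (fun u : R[i] => @K0 R L h u).
Proof.
move=> x y; apply: laurentM; last exact: laurent_const.
rewrite /Kent; case: (x.1 == y.1); last exact: laurent_const.
case: (x.1 == ord0); apply: laurent_csinh; apply: exponentD; try exact: exponent_const.
  exact: exponent_id.
by apply: exponentN; apply: exponent_id.
Qed.

Lemma klaurent_monodromy : klaurent (monodromy g h mu).
Proof.
suff -> : monodromy g h mu = fun u =>
    kmul (kprod [seq R0j g (u - mu j) j | j <- rev (enum 'I_L)])
      (kmul (kprod [seq K | K <- [:: K0 h u]])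
        (kprod [seq R0j g (u + mu j) j | j <- enum 'I_L])).
  apply: klaurent_kmul.
    apply: klaurent_kprod => j; apply: klaurent_R0j.
    by apply: exponentD; [exact: exponent_id | exact: exponent_const].
  apply: klaurent_kmul; last first.
    apply: klaurent_kprod => j; apply: klaurent_R0j.
    by apply: exponentD; [exact: exponent_id | exact: exponent_const].
  apply: klaurent_kmul; first exact: klaurent_K0.
  by move=> x y; apply: laurent_const.
by apply/funext => u; rewrite /monodromy !kprod_cat map_id.
Qed.

Lemma laurent_act (K : R[i] -> spin L -> spin L -> R[i]) (w : R[i] -> qvec R L) s :
  klaurent K -> (forall t, laurent (fun u => w u t)) ->
  laurent (fun u => act (K u) (w u) s).
Proof.
move=> lK lw; under eq_fun => u do rewrite ffunE.
by apply: laurent_sum => t; apply: laurentM.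
Qed.

Lemma qvecZ k (v : qvec R L) s : (k *: v) s = k * v s.
Proof. by rewrite ffunE. Qed.
Lemma qvecZ2 a b (v w : qvec R L) s : (a *: v + b *: w) s = a * v s + b * w s.
Proof. by rewrite !ffunE. Qed.
Lemma qvecZ3 a b c (v w x : qvec R L) s :
  (a *: v + b *: w + c *: x) s = a * v s + b * w s + c * x s.
Proof. by rewrite !ffunE. Qed.
Lemma qvecBZ b (v w : qvec R L) s : (v - b *: w) s = v s - b * w s.
Proof. by rewrite !ffunE. Qed.

Local Notation A u := (act (opA g h mu u)).
Local Notation B u := (act (opB g h mu u)).
Local Notation D u := (act (opD g h mu u)).

Lemma klaurent_opA : klaurent (opA g h mu).
Proof. by move=> x y; apply: klaurent_monodromy. Qed.
Lemma klaurent_opB : klaurent (opB g h mu).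
Proof. by move=> x y; apply: klaurent_monodromy. Qed.
Lemma klaurent_opD : klaurent (opD g h mu).
Proof. by move=> x y; apply: klaurent_monodromy. Qed.

(** The factors b(u + v) and a(u - v) of [rel_BB] are cancelled one after the other as functions of
    [v], so the relation holds at all points. *)
Lemma opB_comm u v w : B u (B v w) = B v (B u w).
Proof.
apply/ffunP => s.
have [z z0] := @csinh_neq0 R.
have lB : laurent (fun v => B u (B v w) s).
  apply: laurent_act => [x y|t]; first exact: laurent_const.
  by apply: laurent_act => [|t']; [exact: klaurent_opB | exact: laurent_const].
have lB' : laurent (fun v => - B v (B u w) s).
  apply: laurentN; apply: laurent_act => [|t]; first exact: klaurent_opB.
  exact: laurent_const.
have lbp : laurent (fun v => wb (u + v)).
  by apply: laurent_csinh; apply: exponentD; [exact: exponent_const | exact: exponent_id].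
have lam : laurent (fun v => wa g (u - v)).
  apply: laurent_csinh; apply: exponentD; last exact: exponent_const.
  apply: exponentD; first exact: exponent_const.
  exact: exponentN exponent_id.
apply/eqP; rewrite -subr_eq0; apply/eqP; move: v.
apply: (laurent_cancel (k := fun v => wb (u + v))) => //.
- exact: laurentD.
- by exists (z - u); rewrite addrC subrK.
apply: (laurent_cancel (k := fun v => wa g (u - v))) => //.
- by apply: laurentM => //; apply: laurentD.
- exists (u + g - z); rewrite /wa.
  by have -> : u - (u + g - z) + g = z by ring.
move=> v; rewrite mulrA mulrBr.
have := congr1 (fun f : qvec R L => f s) (rel_BB g h mu u v w).
by move=> /(etrans (esym (qvecZ _ _ _))) ->; rewrite qvecZ subrr.
Qed.

(* The combination of D and A of which the vacuum is an eigenvector, with eigenvalue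
   [LamD]. *)
Definition opDt u (w : qvec R L) : qvec R L :=
  D u w - (wc g / wa g (2%:R * u)) *: A u w.

Definition diag_op (i : bool) u : qvec R L -> qvec R L :=
  if i then opDt u else A u.

Lemma rel_AB u v w s :
  wa g (v - u) * wb (u + v) * B v (A u w) s =
  wa g (u + v) * wb (v - u) * A u (B v w) s + wb (u + v) * wc g * B u (A v w) s
   + wc g * wb (v - u) * B u (D v w) s.
Proof.
have := congr1 (fun f : qvec R L => f s) (rel_BA g h mu v u w).
move=> /(etrans (esym (qvecZ _ _ _)))/esym/(etrans (esym (qvecZ3 _ _ _ _ _ _ _)))/esym.
by rewrite (addrC v u).
Qed.

Lemma rel_DB_at u v w s :
  wb (u - v) * wb (u + v) * D u (B v w) s + wc g * wc g * A u (B v w) s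
    + wc g * wa g (u + v) * B u (D v w) s =
  wa g (u - v) * wc g * A v (B u w) s + wa g (u - v) * wa g (u + v) * B v (D u w) s.
Proof.
have := congr1 (fun f : qvec R L => f s) (rel_DB g h mu u v w).
by move=> /(etrans (esym (qvecZ3 _ _ _ _ _ _ _)))/esym/(etrans (esym (qvecZ2 _ _ _ _ _)))/esym.
Qed.

(* [rel_AB] eliminates A(u) B(v) and A(v) B(u) from [rel_DB]; every remaining
   term carries the factor b(u + v), which may vanish and is removed by
   analyticity in [v]. *)
Lemma rel_DtB_cleared u v w s : wa g (2%:R * u) != 0 ->
  wb (u - v) * (
    wb (u - v) * wa g (u + v) * wa g (2%:R * v) *
      (D u (B v w) s - wc g / wa g (2%:R * u) * A u (B v w) s)
    - wa g (2%:R * v) * wa g (u - v) * wa g (u + v + g) *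
      (B v (D u w) s - wc g / wa g (2%:R * u) * B v (A u w) s)
    - wc g / wa g (2%:R * u) * wb (2%:R * v) * wa g (2%:R * u + g) * wb (u - v)
      * B u (A v w) s
    + wa g (2%:R * u + g) / wa g (2%:R * u) * wc g * wa g (u + v)
      * (wa g (2%:R * v) * B u (D v w) s - wc g * B u (A v w) s)) = 0.
Proof.
move=> uu; move: v.
apply: (laurent_cancel (k := fun v => wb (u + v))).
- have sl (f : R[i] -> R[i]) : laurent_exponent f -> laurent (fun v => wb (f v)) by exact: laurent_csinh.
  have al f : laurent_exponent f -> laurent (fun v => wa g (f v)).
    by move=> ef; apply: laurent_csinh; apply: exponentD => //; apply: exponent_const.
  have eN : laurent_exponent (fun v : R[i] => u - v).
    by apply: exponentD; [exact: exponent_const | exact: exponentN exponent_id].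
  have eP : laurent_exponent (fun v : R[i] => u + v).
    by apply: exponentD; [exact: exponent_const | exact: exponent_id].
  have eG : laurent_exponent (fun v : R[i] => u + v + g).
    by apply: exponentD => //; exact: exponent_const.
  have e2 : laurent_exponent (fun v : R[i] => 2%:R * v) by apply: exponent2 exponent_id.
  have lB (w' : qvec R L) : laurent (fun v => B v w' s).
    by apply: laurent_act => [|t]; [exact: klaurent_opB | exact: laurent_const].
  have lX (K : spin L -> spin L -> R[i]) (w' : R[i] -> qvec R L) :
      (forall t, laurent (fun v => w' v t)) -> laurent (fun v => act K (w' v) s).
    by move=> lw; apply: laurent_act => // x y; exact: laurent_const.
  have lXB K : laurent (fun v => act K (B v w) s).
    apply: lX => t; apply: laurent_act => [|t']; first exact: klaurent_opB.
    exact: laurent_const.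
  have lXA K : laurent (fun v => act K (A v w) s).
    apply: lX => t; apply: laurent_act => [|t']; first exact: klaurent_opA.
    exact: laurent_const.
  have lXD K : laurent (fun v => act K (D v w) s).
    apply: lX => t; apply: laurent_act => [|t']; first exact: klaurent_opD.
    exact: laurent_const.
  have := (sl _ eN, al _ eN, al _ eP, al _ eG, sl _ e2, al _ e2).
  move=> [[[[[lw1 lw2] lw3] lw4] lw5] lw6].
  apply: laurentM => //; apply: laurentD; first apply: laurentD; first apply: laurentD.
  + do ![apply: laurentM => //]; apply: laurentD => //; apply: laurentN.
    by apply: laurentM => //; exact: laurent_const.
  + apply: laurentN; do ![apply: laurentM => //]; apply: laurentD => //; apply: laurentN.
    by apply: laurentM => //; exact: laurent_const.
  + apply: laurentN; do ![apply: laurentM => //]; exact: laurent_const.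
  + do ![apply: laurentM => //]; try exact: laurent_const.
    by apply: laurentD; [|apply: laurentN]; apply: laurentM => //; exact: laurent_const.
- by apply: laurent_csinh; apply: exponentD; [exact: exponent_const | exact: exponent_id].
- by have [z z0] := @csinh_neq0 R; exists (z - u); rewrite addrC subrK.
move=> v.
have E1 := rel_AB u v w s.
have E2 := rel_AB v u w s.
have E3 := rel_DB_at u v w s.
move: E1 E2 E3; rewrite (addrC v u).
move: (A u (B v w) s) (A v (B u w) s) (D u (B v w) s) (B u (A v w) s) (B v (A u w) s)
  (B u (D v w) s) (B v (D u w) s) => x1 x2 x3 y1 y2 y3 y4 E1 E2 E3.
(* Multipliers of the three relations: [m2] and the second term of [m1] cancel A(v) B(u) and A(u)
   B(v) in [m3] times the D-relation, and the first term of [m1] supplies the A-part of D~(u)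
   B(v). *)
set m1 := wb (u + v) * wb (u - v) * wa g (2%:R * v) * wc g / wa g (2%:R * u)
   + wa g (2%:R * v) * wc g ^+ 2.
set m2 := wa g (u - v) * wc g * wa g (2%:R * v).
set m3 := wb (u - v) * wa g (u + v) * wa g (2%:R * v).
move/eqP: E1; rewrite eq_sym -subr_eq0 => /eqP E1.
move/eqP: E2; rewrite eq_sym -subr_eq0 => /eqP E2.
move/eqP: E3; rewrite -subr_eq0 => /eqP E3.
transitivity (m1 * 0 + m2 * 0 + m3 * 0); last by rewrite !mulr0 !addr0.
rewrite -{1}E1 -{1}E2 -{1}E3 /m1 /m2 /m3.
have num0 (x y : R[i]) : x / y != 0 -> x != 0 by apply: contra_neq => ->; rewrite mul0r.
have a2 x : csinh (2%:R * x + g) =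
    ((cexp x * cexp x * cexp g) ^+ 2 - 1) / (2%:R * cexp x * cexp x * cexp g).
  rewrite !sinhE; move: (cexp_neq0 x) (cexp_neq0 g) => x0 g0.
  by field; rewrite x0 g0.
move: (cexp_neq0 u) (cexp_neq0 v) (cexp_neq0 g) uu.
rewrite /wa /wb /wc !a2 => u0 v0 g0 /num0; rewrite !sinhE.
move: (cexp u) (cexp v) (cexp g) u0 v0 g0 => U V G u0 v0 g0 uu.
field.
by rewrite u0 v0 g0 uu.
Qed.

Lemma diag_op_opB i u v w : cf_ok g u v ->
  diag_op i u (B v w) = cf1 g i u v *: B v (diag_op i u w) +
     \sum_j cf2 g i j u v *: B u (diag_op j v w).
Proof.
case/and4P=> uv0 uv1 uu vv; apply/ffunP => s; rewrite big_bool addrA qvecZ3.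
have vu : wb (v - u) = - wb (u - v) by rewrite /wb -csinhN opprB.
have DtE y x : diag_op true y x s = D y x s - wc g / wa g (2%:R * y) * A y x s.
  exact: qvecBZ.
have BDt x y : B x (diag_op true y w) s =
    B x (D y w) s - wc g / wa g (2%:R * y) * B x (A y w) s.
  by rewrite -qvecBZ -linearZZ -linearB.
have BA x y : B x (diag_op false y w) s = B x (A y w) s by [].
have subst3 (a b c p p' q q' r r' l l' : R[i]) : p = p' -> q = q' -> r = r' -> l = l' ->
    l' = a * p' + b * q' + c * r' -> l = a * p + b * q + c * r.
  by move=> -> -> -> ->.
case: i.
  have := mulfI uv0 (etrans (rel_DtB_cleared v w s uu) (esym (mulr0 _))).
  move=> E; apply: (subst3 _ _ _ _ _ _ _ _ _ _ _ (BDt v u) (BDt u v) (BA u v) (DtE u (B v w))).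
  rewrite /cf1 /cf2; move: E.
  move: (A u (B v w) s) (D u (B v w) s) (B u (A v w) s) (B v (A u w) s)
    (B u (D v w) s) (B v (D u w) s) => x1 x3 y1 y2 y3 y4.
  rewrite (_ : wb (u + v + g) = wa g (u + v)) // (_ : wb (2%:R * u + g) = wa g (2%:R * u)) // => E.
  apply/eqP; rewrite -subr_eq0; apply/eqP.
  transitivity (0 / (wb (u - v) * wa g (u + v) * wa g (2%:R * v))); last by rewrite mul0r.
  by rewrite -[X in _ = X / _]E; field; rewrite uv0 uv1 uu vv.
apply: (subst3 _ _ _ _ _ _ _ _ _ _ _ (BA v u) (BDt u v) (BA u v) (erefl (A u (B v w) s))).
have := rel_AB u v w s.
move: (A u (B v w) s) (B u (A v w) s) (B v (A u w) s) (B u (D v w) s) => x1 y1 y2 y3.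
rewrite /cf1 /cf2 vu (addrC v u) => /eqP; rewrite -subr_eq0 => /eqP E.
(* B(u) A(v) occurs in [rel_AB] directly and through D(v) = D~(v) + (c / a(2v)) A(v); this identity
   merges both into [cf2 g false false u v]. *)
have K : wb (u + v) * wa g (2%:R * v) - wb (2%:R * v) * wa g (u + v) - wc g * wb (u - v) = 0.
  move: (cexp_neq0 u) (cexp_neq0 v) (cexp_neq0 g); rewrite /wa /wb /wc !sinhE => u0 v0 g0.
  by field; rewrite u0 v0 g0.
apply/eqP; rewrite -subr_eq0; apply/eqP.
transitivity ((wa g (u + v) * wb (u - v))^-1 * 0 +
    y1 * wc g / (wa g (u + v) * wa g (2%:R * v) * wb (u - v)) * 0).
  by rewrite -{1}E -K; field; rewrite uv0 uv1 vv.
by rewrite !mulr0 addr0.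
Qed.
End Exchange.

(** * The vacuum *)

Section Vacuum.
Context {R : realType} {L : nat} (g h : R[i]) (mu : 'I_L -> R[i]).

Definition delta_wave (a0 : 'I_2) (t : spin L) : wave (R := R) :=
  fun a s => if (a == a0) && (s == t) then 1 else 0.

Definition scale_wave (k : R[i]) (f : wave (R := R)) : wave (L := L) :=
  fun a s => k * f a s.
Definition add_wave (f f' : wave (R := R)) : wave (L := L) :=
  fun a s => f a s + f' a s.

Lemma wave_ext (f f' : wave (R := R) (L := L)) : (forall a s, f a s = f' a s) -> f = f'.
Proof. by move=> E; apply/funext => a; apply/funext => s. Qed.

Lemma ropZ u j k f : rop g u j (scale_wave k f) = scale_wave k (rop g u j f).
Proof.
by apply: wave_ext => a s; rewrite /rop /scale_wave; case: ifP => _; ring.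
Qed.

Lemma ropD u j f f' : rop g u j (add_wave f f') = add_wave (rop g u j f) (rop g u j f').
Proof.
by apply: wave_ext => a s; rewrite /rop /add_wave; case: ifP => _; ring.
Qed.

Lemma dressedZ js u k f :
  dressed g h mu js u (scale_wave k f) = scale_wave k (dressed g h mu js u f).
Proof.
elim: js f => [|j js IH] f /=; last by rewrite ropZ IH ropZ.
by apply: wave_ext => a s; rewrite /kop /scale_wave mulrCA.
Qed.

Lemma dressedD js u f f' : dressed g h mu js u (add_wave f f') =
  add_wave (dressed g h mu js u f) (dressed g h mu js u f').
Proof.
elim: js f f' => [|j js IH] f f' /=; last by rewrite ropD IH ropD.
by apply: wave_ext => a s; rewrite /kop /add_wave mulrDr.
Qed.

(** Operators at the sites of [js] do not change the spin at [j], so a wave supported where that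
    spin is e_1 stays so. *)
Lemma dressed_fresh js u j f : j \notin js ->
  (forall a (s : spin L), s j != ord0 -> f a s = 0) ->
  forall a (s : spin L), s j != ord0 -> dressed g h mu js u f a s = 0.
Proof.
have rop_fresh k x f' : j != k -> (forall a (s : spin L), s j != ord0 -> f' a s = 0) ->
    forall a (s : spin L), s j != ord0 -> rop g x k f' a s = 0.
  move=> jk f0 a s sj; rewrite /rop !f0 ?upd_other //.
  by rewrite !mulr0 addr0; case: ifP.
elim: js f => [|k js IH] f /=; first by move=> _ f0 a s sj; rewrite /kop f0 // mulr0.
rewrite inE negb_or => /andP[jk jjs] f0.
by apply: (rop_fresh _ _ _ jk); apply: IH => //; apply: rop_fresh.
Qed.

Definition up_value js (u : R[i]) : R[i] :=
  wb (h + u) * \prod_(j <- js) (wa g (u - mu j) * wa g (u + mu j)).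

Lemma rop_up x j (t : spin L) : t j = ord0 ->
  rop g x j (delta_wave ord0 t) = scale_wave (wa g x) (delta_wave ord0 t).
Proof.
move=> tj; apply: wave_ext => a s; rewrite /rop /delta_wave /scale_wave.
case: eqP => [//|ne].
have -> : (a == ord0) && (s == t) = false.
  by apply/negP => /andP[/eqP a0 /eqP st]; apply: ne; rewrite st tj.
have -> : (s j == ord0) && (upd s j a == t) = false.
  apply/negP => /andP[/eqP s0 /eqP st]; apply: ne.
  by rewrite s0 -tj -st upd_same.
by rewrite !mulr0 addr0.
Qed.

(** Only the sites of [js] must be up: in [dressed_down] this is applied to the vacuum with an outer
    spin reversed. *)
Lemma dressed_up js u (t : spin L) : (forall j, j \in js -> t j = ord0) ->
  dressed g h mu js u (delta_wave ord0 t) =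
  scale_wave (up_value js u) (delta_wave ord0 t).
Proof.
elim: js => [|j js IH] tj /=.
  apply: wave_ext => a s; rewrite /kop /scale_wave /delta_wave /up_value big_nil mulr1.
  by case: (ord2P a) => ->; rewrite /Kent //= !mulr0.
rewrite rop_up ?tj ?mem_head // dressedZ IH; last first.
  by move=> k kjs; apply: tj; rewrite inE kjs orbT.
rewrite !ropZ rop_up ?tj ?mem_head //.
apply: wave_ext => a s; rewrite /scale_wave /up_value big_cons; ring.
Qed.

Definition down_value js (u : R[i]) : R[i] :=
  - (wb (2%:R * u) / wa g (2%:R * u)) * wa g (u - h) *
     \prod_(j <- js) (wb (u - mu j) * wb (u + mu j))
  + wc g / wa g (2%:R * u) * up_value js u.

Lemma down_value_nil u : wa g (2%:R * u) != 0 -> down_value [::] u = csinh (h - u).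
Proof.
move=> uu; rewrite /down_value /up_value !big_nil !mulr1.
have K : wa g (2%:R * u) * csinh (h - u) + wb (2%:R * u) * wa g (u - h)
    - wc g * wb (h + u) = 0.
  move: (cexp_neq0 u) (cexp_neq0 g) (cexp_neq0 h).
  rewrite /wa /wb /wc !sinhE => u0 g0 h0; by field; rewrite u0 g0 h0.
apply/eqP; rewrite -subr_eq0; apply/eqP.
by rewrite -[RHS](mulr0 (- (wa g (2%:R * u))^-1)) -[X in _ = _ * X]K; field.
Qed.

(** The term with c^2 is the path on which the spin of [j] is reversed on the way in and restored on
    the way out. *)
Lemma down_value_cons j js u : wa g (2%:R * u) != 0 ->
  down_value (j :: js) u =
  wb (u - mu j) * wb (u + mu j) * down_value js u + wc g ^+ 2 * up_value js u.
Proof.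
move=> uu; rewrite /down_value /up_value !big_cons.
have K : wa g (u - mu j) * wa g (u + mu j) - wb (u - mu j) * wb (u + mu j)
   - wc g * wa g (2%:R * u) = 0.
  move: (cexp_neq0 u) (cexp_neq0 g) (cexp_neq0 (mu j)).
  rewrite /wa /wb /wc !sinhE => u0 g0 h0; by field; rewrite u0 g0 h0.
move: (\prod_(i <- js) (wb (u - mu i) * wb (u + mu i)))
  (\prod_(i <- js) (wa g (u - mu i) * wa g (u + mu i))) => p q.
apply/eqP; rewrite -subr_eq0; apply/eqP.
by rewrite -[RHS](mulr0 (wc g / wa g (2%:R * u) * wb (h + u) * q)) -[X in _ = _ * X]K; field.
Qed.

(* Passing the outermost site turns e_2 (x) vac into itself plus a term with the
   spin of that site reversed, on which the inner operator acts by [dressed_up]. *)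
Lemma dressed_down js u s : wa g (2%:R * u) != 0 -> uniq js ->
  dressed g h mu js u (delta_wave ord_max (vac L)) ord_max s =
  down_value js u * (if s == vac L then 1 else 0).
Proof.
move=> uu; elim: js s => [|j js IH] s.
  by rewrite /= /kop /delta_wave /Kent /= down_value_nil.
move=> /= /andP[jjs js_uniq].
have vacj k : vac L k = ord0 by rewrite ffunE.
set t := upd (vac L) j ord_max.
have rop_down x : rop g x j (delta_wave ord_max (vac L)) =
    add_wave (scale_wave (wb x) (delta_wave ord_max (vac L)))
             (scale_wave (wc g) (delta_wave ord0 t)).
  apply: wave_ext => a s'; rewrite /rop /add_wave /scale_wave /delta_wave.
  case: eqP => [asj|ne].
    have -> : (a == ord_max) && (s' == vac L) = false.
      by apply/negP => /andP[/eqP a1 /eqP sv]; move: asj; rewrite a1 sv vacj.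
    have -> : (a == ord0) && (s' == t) = false.
      by apply/negP => /andP[/eqP a0 /eqP st]; move: asj; rewrite a0 st upd_same.
    by rewrite !mulr0 addr0.
  suff -> : (s' j == ord_max) && (upd s' j a == vac L) = (a == ord0) && (s' == t) by [].
  apply/andP/andP => -[/eqP e1 /eqP e2].
    have a0 : a = ord0 by rewrite -(upd_same s' j a) e2 vacj.
    by rewrite a0 eqxx /t -e2 upd_upd -e1 upd_id eqxx.
  rewrite e2 /t upd_same eqxx e1 upd_upd; split => //; apply/eqP.
  by rewrite -[RHS](upd_id _ j) vacj.
rewrite rop_down dressedD !dressedZ.
rewrite [in scale_wave _ (dressed _ _ _ _ _ (delta_wave ord0 t))]dressed_up; last first.
  by move=> k kjs; rewrite upd_other ?vacj //; apply: contraNneq jjs => <-.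
(* The term whose spin at [j] was not reversed vanishes wherever that spin is down, so only the
   reversed term contributes to the final exchange. *)
have fresh := @dressed_fresh js u j (delta_wave ord_max (vac L)) jjs.
have {}fresh a (s' : spin L) : s' j != ord0 ->
    dressed g h mu js u (delta_wave ord_max (vac L)) a s' = 0.
  apply: fresh => b s'' sj; rewrite /delta_wave.
  case: (s'' =P vac L) => [E|]; last by rewrite andbF.
  by rewrite E vacj in sj.
rewrite /rop /add_wave /scale_wave.
case: eqP => [sj|/eqP ne].
  rewrite fresh -?sj // /delta_wave /=.
  case: eqP => [E|_]; first by rewrite E vacj in sj.
  by ring.
have sj : s j = ord0 by case: (ord2P (s j)) ne => ->.
rewrite IH // fresh ?upd_same // /delta_wave /= sj /=.
have -> : (upd s j ord_max == t) = (s == vac L).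
  apply/eqP/eqP => [E|->//].
  by rewrite -(upd_id s j) sj -(upd_upd s j ord_max) E /t upd_upd -(vacj j) upd_id.
by rewrite down_value_cons //; case: eqP => _; ring.
Qed.

Definition vacv : qvec R L := [ffun s => if s == vac L then 1 else 0].

Lemma dressed_vac u a a0 s :
  dressed g h mu (rev (enum 'I_L)) u (delta_wave a0 (vac L)) a s =
  act (mono g h mu a a0 u) vacv s.
Proof.
rewrite dressedE ffunE (bigD1 a0) //= [X in _ + X]big1 ?addr0.
  by apply: eq_bigr => t _; rewrite ffunE /delta_wave eqxx.
move=> a' /negPf ne; rewrite big1 // => t _.
by rewrite /delta_wave ne mulr0.
Qed.

Lemma up_value_LamA u : up_value (rev (enum 'I_L)) u = LamA g h mu u.
Proof.
rewrite /up_value /LamA; congr (_ * _).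
by rewrite (perm_big (enum 'I_L)) ?perm_rev // big_enum.
Qed.

Lemma opA_vac u : act (opA g h mu u) vacv = LamA g h mu u *: vacv.
Proof.
apply/ffunP => s; rewrite -[LHS](dressed_vac u ord0 ord0) dressed_up; last by move=> j _; rewrite ffunE.
by rewrite up_value_LamA /scale_wave /delta_wave !ffunE.
Qed.

Lemma opDt_vac u : wa g (2%:R * u) != 0 ->
  opDt g h mu u vacv = LamD g h mu u *: vacv.
Proof.
move=> uu; apply/ffunP => s; rewrite /opDt opA_vac qvecBZ.
rewrite -[act (opD g h mu u) vacv s](dressed_vac u ord_max ord_max).
rewrite dressed_down ?rev_uniq ?enum_uniq // !qvecZ /down_value up_value_LamA.
rewrite (perm_big (enum 'I_L)) ?perm_rev // big_enum /= /LamD ffunE.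
by case: eqP => _; ring.
Qed.

End Vacuum.

(** * Scalar products *)

Section ScalarProduct.
Context {R : realType} {L : nat} (g h : R[i]).

Definition actB (mu : 'I_L -> R[i]) (u : R[i]) : {linear qvec R L -> qvec R L} :=
  act (opB g h mu u).

Definition bstate mu (Y : seq R[i]) : qvec R L := bethe (actB mu) (vacv (R := R)) Y.

Lemma opDt_bstate mu n (u : R[i]) Y : size Y = n -> wa g (2%:R * u) != 0 ->
  all (cf_ok g u) Y -> pairwise (cf_ok g) Y ->
  opDt g h mu u (bstate mu Y) =
  (LamD g h mu u * prodZ g u Y) *: bstate mu Y +
  \sum_(k < n) Ntil g h mu u Y k *: bstate mu (u :: del_at k Y).
Proof.
move=> <- uu uY YY.
pose Lam (i : bool) := if i then LamD g h mu else LamA g h mu.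
have O_vac (i : bool) v : wa g (2%:R * v) != 0 -> diag_op g h mu i v vacv = Lam i v *: vacv.
  by case: i => v0; [exact: opDt_vac | exact: opA_vac].
have ok_good v w : cf_ok g v w -> wa g (2%:R * w) != 0 by case/and4P.
apply: etrans (@offshell_action _ _ _ _ (actB mu) (diag_op g h mu) vacv Lam (cf1 g) (cf2 g)
  (fun v => wa g (2%:R * v) != 0) (cf_ok g) O_vac ok_good (opB_comm g h mu)
  (@diag_op_opB R L g h mu) (@cf2_eq R g) true u Y uu uY YY) _.
congr (_ + _); apply: eq_bigr => k _; congr (_ *: _).
rewrite big_bool /Ntil /prod1 /prod2 /cf1 /cf2 /= addrC.
move: (\prod_(_ < _ | _) _) (\prod_(_ < _ | _) _) => p q.
ring.
Qed.

(** Bilinear, without conjugation, so that the adjoint of a matrix is its plain transpose. *)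
Definition pairing (v w : qvec R L) : R[i] := \sum_t v t * w t.

Lemma pairingDr v w w' : pairing v (w + w') = pairing v w + pairing v w'.
Proof. by rewrite -big_split; apply: eq_bigr => t _; rewrite ffunE mulrDr. Qed.
Lemma pairingZr k v w : pairing v (k *: w) = k * pairing v w.
Proof. by rewrite /pairing mulr_sumr; apply: eq_bigr => t _; rewrite ffunE mulrCA. Qed.
Lemma pairing0r v : pairing v 0 = 0.
Proof. by rewrite /pairing big1 // => t _; rewrite ffunE mulr0. Qed.
Lemma pairing_sumZr n v (c : 'I_n -> R[i]) (W : 'I_n -> qvec R L) :
  pairing v (\sum_k c k *: W k) = \sum_k c k * pairing v (W k).
Proof.
rewrite (big_morph (pairing v) (pairingDr v) (pairing0r v)).
by apply: eq_bigr => k _; apply: pairingZr.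
Qed.
Lemma pairingC v w : pairing v w = pairing w v.
Proof. by apply: eq_bigr => t _; rewrite mulrC. Qed.

Lemma pairing_act (K : spin L -> spin L -> R[i]) v w :
  pairing v (act K w) = pairing (act (ktr K) v) w.
Proof.
rewrite /pairing; under eq_bigr => t _ do rewrite ffunE mulr_sumr.
rewrite exchange_big; apply: eq_bigr => t _; rewrite ffunE mulr_suml.
by apply: eq_bigr => t' _; rewrite /ktr mulrCA mulrA.
Qed.

Variable mu : 'I_L -> R[i].

Definition mu_opp (j : 'I_L) := - mu j.

Lemma ktr_R0j u (j : 'I_L) : ktr (R0j g u j) = R0j g u j.
Proof.
apply/funext => x; apply/funext => y; rewrite /ktr /R0j.
have -> : [forall k, (k != j) ==> (y.2 k == x.2 k)] =
    [forall k, (k != j) ==> (x.2 k == y.2 k)].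
  by apply: eq_forallb => k; rewrite (eq_sym (y.2 k)).
congr (_ * _); rewrite /Rent.
case: (ord2P x.1) => ->; case: (ord2P (x.2 j)) => ->;
  by case: (ord2P y.1) => ->; case: (ord2P (y.2 j)) => ->.
Qed.

Lemma ktr_K0 u : ktr (@K0 R L h u) = K0 h u.
Proof.
apply/funext => x; apply/funext => y; rewrite /ktr /K0 (eq_sym y.2); congr (_ * _).
by rewrite /Kent; case: (ord2P x.1) => ->; case: (ord2P y.1) => ->.
Qed.

(* All factors are symmetric, so transposition reverses the product, which
   exchanges the factors at [l - mu j] with those at [l + mu j]. *)
Lemma ktr_monodromy u : ktr (monodromy g h mu u) = monodromy g h mu_opp u.
Proof.
rewrite /monodromy; move: (enum 'I_L) => js.
rewrite ktr_kprod !map_cat !rev_cat -catA /= ktr_K0 -!map_comp -!map_rev revK.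
by congr (kprod (_ ++ _ :: _)); apply: eq_map => j /=; rewrite ktr_R0j /mu_opp ?opprK.
Qed.

Lemma ktr_opA u : ktr (opA g h mu u) = opA g h mu_opp u.
Proof. by rewrite /opA -ktr_monodromy. Qed.
Lemma ktr_opC u : ktr (opC g h mu u) = opB g h mu_opp u.
Proof. by rewrite /opB -ktr_monodromy. Qed.
Lemma ktr_opD u : ktr (opD g h mu u) = opD g h mu_opp u.
Proof. by rewrite /opD -ktr_monodromy. Qed.

Lemma pairing_opDt u v w :
  pairing v (opDt g h mu u w) = pairing (opDt g h mu_opp u v) w.
Proof.
rewrite /opDt -!scaleNr pairingDr pairingZr !pairing_act ktr_opA ktr_opD.
by rewrite ![pairing _ w]pairingC pairingDr pairingZr.
Qed.

Lemma LamA_opp u : LamA g h mu_opp u = LamA g h mu u.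
Proof.
rewrite /LamA; congr (_ * _); apply: eq_bigr => j _.
by rewrite /mu_opp opprK mulrC.
Qed.

Lemma LamD_opp u : LamD g h mu_opp u = LamD g h mu u.
Proof.
rewrite /LamD; congr (_ * _); apply: eq_bigr => j _.
by rewrite /mu_opp opprK mulrC.
Qed.

Lemma Ntil_opp u n Y (k : 'I_n) : Ntil g h mu_opp u Y k = Ntil g h mu u Y k.
Proof. by rewrite /Ntil LamA_opp LamD_opp. Qed.

Lemma bstateE mu' Y t :
  bstate mu' Y t = kprod [seq opB g h mu' y | y <- Y] t (vac L).
Proof.
elim: Y t => [|y Y IH] t; first by rewrite ffunE.
rewrite /bstate bethe_cons /= ffunE; apply: eq_bigr => s _.
by congr (_ * _); exact: IH.
Qed.

(** Transposing the row vector made of the C's reverses their order, which undoes [rev xC], and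
    turns each C into a B at [mu_opp]. *)
Lemma SnE xC xB : Sn g h mu xC xB = pairing (bstate mu_opp xC) (bstate mu xB).
Proof.
rewrite /Sn kprod_cat; apply: eq_bigr => t _; rewrite !bstateE; congr (_ * _).
rewrite -[LHS]/(ktr _ t (vac L)) ktr_kprod -map_comp map_rev revK.
by congr (kprod _ _ _); apply: eq_map => y /=; rewrite ktr_opC.
Qed.

End ScalarProduct.

Unset Implicit Arguments.

Theorem theorem2 (R : realType) (g h : R[i]) (L : nat) (mu : 'I_L -> R[i])
    (n : nat) (l0 : R[i]) (xC xB : seq R[i]) :
  (1 <= L)%N -> (1 <= n)%N -> size xC = n -> size xB = n ->
  (* genericity: every denominator occurring in the identity is nonzero *)
  wa g (2%:R * l0) != 0 ->
  wb (2%:R * l0 + g) != 0 ->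
  (forall x, x \in xC ++ xB ->
     [/\ wb (l0 - x) != 0, wb (l0 + x + g) != 0,
         wa g (2%:R * x) != 0 & wa g (l0 + x) != 0]) ->
  (forall Z, Z \in [:: xC; xB] -> forall j k : 'I_n, j != k ->
     [/\ wb (nth 0 Z j - nth 0 Z k) != 0, wa g (nth 0 Z j + nth 0 Z k) != 0
       & wb (nth 0 Z j + nth 0 Z k + g) != 0]) ->
  Mtil g h mu l0 xC xB * Sn g h mu xC xB
  + \sum_(k < n) NtilC g h mu l0 xC k * Sn g h mu (l0 :: del_at k xC) xB
  + \sum_(k < n) NtilB g h mu l0 xB k * Sn g h mu xC (l0 :: del_at k xB)
  = 0.
Proof.
move=> _ _ sC sB uu _ ok0 ok2.
have ok_all Z : {subset Z <= xC ++ xB} -> all (cf_ok g l0) Z.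
  move=> ZS; apply/allP => x /ZS /ok0[? _ ? ?]; exact/and4P.
have ok_pair Z : size Z = n -> Z \in [:: xC; xB] -> {subset Z <= xC ++ xB} ->
    pairwise (cf_ok g) Z.
  move=> sZ Zin ZS; apply/(pairwiseP 0) => i j; rewrite !inE sZ => iN jN ij.
  have ne : Ordinal iN != Ordinal jN by rewrite -val_eqE /= ltn_eqF.
  have [d1 d2 _] := ok2 Z Zin _ _ ne.
  have [_ _ d3 _] := ok0 _ (ZS _ (mem_nth 0 (etrans (congr1 (leq i.+1) sZ) iN))).
  have [_ _ d4 _] := ok0 _ (ZS _ (mem_nth 0 (etrans (congr1 (leq j.+1) sZ) jN))).
  exact/and4P.
have CS : {subset xC <= xC ++ xB} by move=> x; rewrite mem_cat => ->.
have BS : {subset xB <= xC ++ xB} by move=> x; rewrite mem_cat orbC => ->.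
have actC := opDt_bstate h (mu_opp mu) sC uu (ok_all _ CS)
  (ok_pair _ sC (mem_head _ _) CS).
have actB := opDt_bstate h mu sB uu (ok_all _ BS)
  (ok_pair _ sB (mem_last xC [:: xB]) BS).
have := pairing_opDt g h mu l0 (bstate g h (mu_opp mu) xC) (bstate g h mu xB).
rewrite actB actC [RHS]pairingC !pairingDr !pairingZr !pairing_sumZr LamD_opp.
rewrite [pairing (bstate _ _ _ xB) _]pairingC -SnE => E.
(* Here [a] and [b] are the diagonal terms of the right and the left action, which form [Mtil]; [d]
   and [c] are the corresponding exchanged sums. *)
have cancel (a b c d : R[i]) : a + d = b + c -> a - b - c + d = 0.
  by move/eqP; rewrite -subr_eq0 => /eqP <-; ring.
rewrite /Mtil mulrBr mulrBl.
under [X in _ + X + _ = _]eq_bigr => k _ do rewrite /NtilC mulNr.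
rewrite sumrN; apply: cancel; apply: etrans (etrans _ E) _; congr (_ + _).
  by apply: eq_bigr => k _; rewrite -SnE.
by apply: eq_bigr => k _; rewrite pairingC -SnE Ntil_opp.
Qed.
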